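(* Let $G=\bigcup_{j=1}^N G_j$ be an archipelago with boundary curves $\Gamma_j=\partial G_j$. For every $j=1,2,\ldots,N$ and any $n\in\mathbb{N}$, $$\Lambda_n^{G_j}(z)\le \Lambda_n(z),\quad z\in\mathbb{C}.$$ In addition, if $\Gamma_j$ is analytic, then there exist a sequence $\{\gamma_n\}_{n=0}^\infty$ with $0<\gamma_n<1$ and $\lim_{n\to\infty}\gamma_n=0$ geometrically (that is, $\gamma_n=O(\alpha^n)$ for some $0<\alpha<1$), and a number $m\in\mathbb{N}$, $m\ge 1$, such that for any $n\in\mathbb{N}$, $$\frac{1-\gamma_n}{2}\,\Lambda_{mn}(z)\le \Lambda_n^{G_j}(z),\quad z\in\overline{G}_j.$$
   Context: Archipelago: $N\ge 2$ is an integer and $G_1,\dots,G_N\subset\mathbb{C}$ are bounded Jordan domains (interiors of Jordan curves) with mutually disjoint closures; $G=\bigcup_{j=1}^N G_j$, $\Gamma_j=\partial G_j$. Bergman polynomials of $G$: $P_n(z)=\lambda_n z^n+\cdots$, $\lambda_n>0$, $n=0,1,2,\ldots$, are the polynomials obtained by orthonormalizing $1,z,z^2,\ldots$ with respect to $\langle f,g\rangle=\int_G f\,\overline{g}\,dA$ ($dA$ is area measure). Similarly $P_{n,j}(z)=\lambda_{n,j}z^n+\cdots$, $\lambda_{n,j}>0$, are the Bergman polynomials of the single domain $G_j$ (inner product $\int_{G_j}f\,\overline{g}\,dA$). Square roots of Christoffel functions, for $z\in\mathbb{C}$: $$\Lambda_n(z)=\Big(\sum_{k=0}^n|P_k(z)|^2\Big)^{-1/2},\qquad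 \Lambda_n^{G_j}(z)=\Big(\sum_{k=0}^n|P_{k,j}(z)|^2\Big)^{-1/2}.$$ An analytic Jordan curve is the image of the unit circle under a function analytic and univalent in a neighborhood of the circle. *)

(* Defs.v *)
From HB Require Import structures.
From mathcomp Require Import all_boot all_order all_algebra.
From mathcomp Require Import complex.
From mathcomp Require Import all_classical all_reals all_analysis.

Set Implicit Arguments.
Unset Strict Implicit.
Unset Printing Implicit Defensive.

Import Order.TTheory GRing.Theory Num.Theory numFieldNormedType.Exports.
Local Open Scope classical_set_scope.
Local Open Scope ring_scope.
Local Open Scope complex_scope.

(* R[i] as a normed space over itself, so that the topology is the one of the
   modulus and [derivable f z 1] is complex differentiability at z. *)
HB.instance Definition _ (R : realType) := NormedModule.copy R[i] R[i]^o.

Section Curves.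
Context {R : realType}.
Local Notation C := R[i].

Definition unit_circle : set C := [set z | `|z| = 1].

Definition jordan_curve (L : set C) : Prop :=
  exists f : C -> C,
    [/\ {within unit_circle, continuous f},
        {in unit_circle &, injective f} &
        L = f @` unit_circle].

Definition analytic_jordan_curve (L : set C) : Prop :=
  exists (U : set C) (f : C -> C),
    [/\ open U, unit_circle `<=` U, (forall z, U z -> derivable f z 1),
        {in U &, injective f} &
        L = f @` unit_circle].

(* The points off L whose component in the complement of L is bounded; for a
   Jordan curve there is exactly one such component. *)
Definition jordan_interior (L : set C) : set C :=
  [set z | ~ L z /\ bounded_set (connected_component (~` L) z)].

Definition jordan_domain (D : set C) : Prop :=
  exists2 L, jordan_curve L & D = jordan_interior L.

Definition boundary (D : set C) : set C := closure D `\` D^°.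

Definition archipelago (N : nat) (G : 'I_N -> set C) : Prop :=
  [/\ (2 <= N)%N, (forall j, jordan_domain (G j)) &
      (forall i j, i != j -> closure (G i) `&` closure (G j) = set0)].

End Curves.

Section Bergman.
Context {R : realType}.
Local Notation C := R[i].

Definition area_measure :
    {measure set (measurableTypeR R * measurableTypeR R) -> \bar R} :=
  (@lebesgue_measure R \x @lebesgue_measure R)%E.

(* The integral of h over D with respect to dA, computed in the coordinates
   (x, y) of z = x +i* y. *)
Definition area_integral (D : set C) (h : C -> C) : C :=
  let D2 := [set w : R * R | D (w.1 +i* w.2)] in
  (\int[area_measure]_(w in D2) complex.Re (h (w.1 +i* w.2)))
  +i* (\int[area_measure]_(w in D2) complex.Im (h (w.1 +i* w.2))).

Definition L2_inner (D : set C) (f g : C -> C) : C :=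
  area_integral D (fun z => f z * (g z)^*).

(* [0 < lead_coef _] in R[i] says that the coefficient is real and positive;
   with the degrees and orthonormality this determines the sequence, which is
   the one produced by Gram-Schmidt from 1, 'X, 'X^2, and so on. *)
Definition bergman_polynomials (D : set C) (P : nat -> {poly C}) : Prop :=
  [/\ (forall n, size (P n) = n.+1),
      (forall n, 0 < lead_coef (P n)) &
      (forall m n, L2_inner D (horner (P m)) (horner (P n)) = (m == n)%:R)].

Definition sqrt_christoffel (P : nat -> {poly C}) (n : nat) (z : C) : R :=
  (Num.sqrt (\sum_(k < n.+1) Normc.normc (P k).[z] ^+ 2))^-1.

End Bergman.

(* Main.v *)
(* Both inequalities come from the extremal property of the Christoffel function:
   [Lambda_n(z)^2] is the minimum of [||p||^2] over the polynomials [p] of degree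
   at most [n] with [|p(z)| = 1].  The first one is monotonicity of the norm in
   the domain.  For the second one, an extremal polynomial [p] of [G_j] is
   multiplied by a polynomial [q] that is close to [1] on [G_j] and geometrically
   small on the other islands, faster than [p] can grow there (a bound obtained by
   Lagrange interpolation at points of a square inside [G_j]).  The polynomial [q]
   is the composition of a binomial tail polynomial of degree [2n] with a fixed
   polynomial approximating the indicator function of [G_j] on the closed islands.
   The latter exists by Runge's theorem, whose topological input is that a point
   [a] off the closed islands lies in no hole of their union: [z - a] extends from
   each of them to a nonvanishing continuous map of the plane, hence also from
   their union, and filling a hole around [a] with this extension would produce a
   retraction of a disk onto its boundary. *)
Require Import Defs.
From HB Require Import structures.
From mathcomp Require Import all_boot all_order all_algebra.
From mathcomp Require Import complex.
From mathcomp Require Import all_classical all_reals all_analysis.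
From mathcomp Require Import measurable_realfun.
From mathcomp Require Import ring lra.

Set Implicit Arguments.
Unset Strict Implicit.
Unset Printing Implicit Defensive.

Import Order.TTheory GRing.Theory Num.Theory numFieldNormedType.Exports.
Local Open Scope classical_set_scope.
Local Open Scope ring_scope.

Local Open Scope complex_scope.

(** About a Jordan curve two facts are used: it is compact and it contains no disc. The complement
    of the closure of an island is then handled by an induction principle over its points. A
    nonvanishing extension of [z - a] that equals 1 away from the island takes the place of a branch
    of the logarithm; being multiplicative, such extensions for several islands combine by a plain
    product. Cauchy's formula enters without contours: the integral of 1/zeta over an edge is
    replaced by a closed formula in [ln] and [atan], whose sum over a square is computed exactly
    wherever the pole lies, even on the boundary. The factor 1/2 in the second inequality leaves
    room for constants: it suffices to bound the quotient of the two kernels by 4 in every positive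
    degree, so the growth of the extremal polynomial on the other islands, a power of [rho], and
    their area only have to be beaten by [(8 * e) ^+ n] with [e] fixed in advance. In degree 0 no
    separation takes place, and the first term of [gamma] absorbs the quotient. *)

Local Notation nrm := (@Normc.normc _).
Local Notation cRe := (@complex.Re _).
Local Notation cIm := (@complex.Im _).

(** * Complex numbers *)

Section ComplexModulus.
Context {R : realType}.
Local Notation C := R[i].
Implicit Types (x y z a : C) (r s t : R).

Lemma nrmE z : `|z| = (nrm z)%:C. Proof. by []. Qed.

Lemma nrm_ge0 z : 0 <= nrm z.
Proof. by case: z => a b; rewrite sqrtr_ge0. Qed.

Lemma nrm_eq0 z : (nrm z == 0) = (z == 0).
Proof.
by apply/eqP/eqP => [/Normc.eq0_normc//|->]; rewrite Normc.normc0.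
Qed.

Lemma nrm_gt0 z : (0 < nrm z) = (z != 0).
Proof. by rewrite lt_def nrm_eq0 nrm_ge0 andbT. Qed.

Lemma nrmN z : nrm (- z) = nrm z. Proof. exact: normcN. Qed.

Lemma nrmD x y : nrm (x + y) <= nrm x + nrm y. Proof. exact: le_normcD. Qed.

Lemma nrmB x y : nrm (x - y) <= nrm x + nrm y.
Proof. by rewrite -(nrmN y) nrmD. Qed.

Lemma nrmBC x y : nrm (x - y) = nrm (y - x).
Proof. by rewrite -nrmN opprB. Qed.

Lemma nrm_dist_tri y x z : nrm (x - z) <= nrm (x - y) + nrm (y - z).
Proof. by rewrite -[in leLHS](subrK y x) -addrA nrmD. Qed.

Lemma nrm_sub_ge x y : nrm x - nrm y <= nrm (x - y).
Proof. by rewrite lerBlDr -[in leLHS](subrK y x) nrmD. Qed.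

Lemma nrmM x y : nrm (x * y) = nrm x * nrm y. Proof. exact: Normc.normcM. Qed.

Lemma nrmV z : nrm z^-1 = (nrm z)^-1. Proof. exact: Normc.normcV. Qed.

Lemma nrmX z n : nrm (z ^+ n) = nrm z ^+ n.
Proof. by elim: n => [|n IHn]; rewrite ?Normc.normc1// !exprS nrmM IHn. Qed.

Lemma nrm_real r : nrm r%:C = `|r|.
Proof. by rewrite /= expr0n addr0 sqrtr_sqr. Qed.

Lemma nrm_i : nrm ('i : C) = 1.
Proof. by rewrite /= expr0n add0r expr1n sqrtr1. Qed.

Lemma nrm_nat n : nrm (n%:R : C) = n%:R.
Proof. by rewrite -(rmorph_nat (real_complex R)) nrm_real ger0_norm. Qed.

Lemma sqr_nrm z : nrm z ^+ 2 = cRe z ^+ 2 + cIm z ^+ 2.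
Proof. by case: z => a b; rewrite sqr_sqrtr// addr_ge0 ?sqr_ge0. Qed.

Lemma Re_le_nrm z : `|cRe z| <= nrm z.
Proof.
by case: z => a b /=; rewrite -sqrtr_sqr ler_sqrt ?addr_ge0 ?sqr_ge0// lerDl sqr_ge0.
Qed.

Lemma Im_le_nrm z : `|cIm z| <= nrm z.
Proof.
by case: z => a b /=; rewrite -sqrtr_sqr ler_sqrt ?addr_ge0 ?sqr_ge0// lerDr sqr_ge0.
Qed.

Lemma nrm_le_ReIm z : nrm z <= `|cRe z| + `|cIm z|.
Proof.
rewrite -(@ler_pXn2r _ 2) ?nnegrE ?nrm_ge0 ?addr_ge0//.
rewrite sqr_nrm sqrrD !real_normK ?num_real// lerD2r lerDl.
by rewrite mulrn_wge0// mulr_ge0.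
Qed.

Lemma nrm_conj z : nrm z^* = nrm z.
Proof. by case: z => a b; rewrite /= sqrrN. Qed.

Lemma mul_conj z : z * z^* = (nrm z ^+ 2)%:C.
Proof.
rewrite sqr_nrm; case: z => a b /=; apply/eqP; rewrite eq_complex /=; apply/andP.
by split; apply/eqP; rewrite ?mulrN ?opprK ?(mulrC b a) ?addNr.
Qed.

Lemma ReD x y : cRe (x + y) = cRe x + cRe y. Proof. by case: x y => [? ?] []. Qed.
Lemma ImD x y : cIm (x + y) = cIm x + cIm y. Proof. by case: x y => [? ?] []. Qed.
Lemma ReN x : cRe (- x) = - cRe x. Proof. by case: x. Qed.
Lemma ImN x : cIm (- x) = - cIm x. Proof. by case: x. Qed.

Lemma nrm_sum (I : Type) (s : seq I) (P : pred I) (F : I -> C) :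
  nrm (\sum_(i <- s | P i) F i) <= \sum_(i <- s | P i) nrm (F i).
Proof.
apply: (big_ind2 (fun (u : C) (v : R) => nrm u <= v)) => //.
- by rewrite Normc.normc0.
- by move=> u1 v1 u2 v2 h1 h2; apply: le_trans (nrmD _ _) (lerD h1 h2).
Qed.

End ComplexModulus.

Arguments Normc.normc : simpl never.

(** * Continuity, and the topology of the plane in terms of the modulus *)

Lemma cont_comp (T U V : topologicalType) (f : T -> U) (g : U -> V) :
  continuous f -> continuous g -> continuous (fun x => g (f x)).
Proof. by move=> cf cg x; apply: continuous_comp; [exact: cf|exact: cg]. Qed.

Section PointwiseContinuity.
Context {K : numFieldType} {T : topologicalType}.
Implicit Types f g : T -> K.

Lemma cont_cst (k : K) : continuous (fun _ : T => k).
Proof. exact: cst_continuous. Qed.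

Lemma contD f g : continuous f -> continuous g -> continuous (fun x => f x + g x).
Proof. by move=> cf cg x; apply: (@cvgD K K T (nbhs x) _ f g); [exact: cf|exact: cg]. Qed.

Lemma contN f : continuous f -> continuous (fun x => - f x).
Proof. by move=> cf x; apply: (@cvgN K K T (nbhs x) _ f); exact: cf. Qed.

Lemma contM f g : continuous f -> continuous g -> continuous (fun x => f x * g x).
Proof. by move=> cf cg x; apply: (@cvgM K T (nbhs x) _ f g); [exact: cf|exact: cg]. Qed.

Lemma contV f : (forall x, f x != 0) -> continuous f -> continuous (fun x => (f x)^-1).
Proof. by move=> f0 cf x; apply: (@cvgV K T (nbhs x) _ f) => //; exact: cf. Qed.

Lemma cont_sum (I : Type) (s : seq I) (F : I -> T -> K) :
  (forall i, continuous (F i)) -> continuous (fun x => \sum_(i <- s) F i x).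
Proof.
move=> cF; elim: s => [|i s IHs].
  rewrite (_ : (fun _ => _) = fun=> 0); first exact: cont_cst.
  by apply/funext => x; rewrite big_nil.
rewrite (_ : (fun _ => _) = fun x => F i x + \sum_(j <- s) F j x).
  exact: contD.
by apply/funext => x; rewrite big_cons.
Qed.

Lemma cont_prod (I : Type) (s : seq I) (F : I -> T -> K) :
  (forall i, continuous (F i)) -> continuous (fun x => \prod_(i <- s) F i x).
Proof.
move=> cF; elim: s => [|i s IHs].
  rewrite (_ : (fun _ => _) = fun=> 1); first exact: cont_cst.
  by apply/funext => x; rewrite big_nil.
rewrite (_ : (fun _ => _) = fun x => F i x * \prod_(j <- s) F j x).
  exact: contM.
by apply/funext => x; rewrite big_cons.
Qed.

End PointwiseContinuity.

Section ComplexTopology.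
Context {R : realType}.
Local Notation C := R[i].
Implicit Types (x y z a : C) (r s t : R).

Lemma nbhsCP (a : C) (A : set C) :
  nbhs a A <-> exists2 e : R, 0 < e & forall z, nrm (z - a) < e -> A z.
Proof.
split.
- move/nbhs_ballP => [e /= e0 eA]; case: e e0 eA => e e' /=.
  rewrite ltcE /= => /andP[/eqP -> e0] eA; exists e => // z za; apply: eA.
  by rewrite -ball_normE /ball_ /= -[_ < _]/(`|a - z| < e%:C) nrmE ltcR nrmBC.
- move=> [e e0 eA]; apply/nbhs_ballP; exists e%:C => /=; first by rewrite ltcR.
  by move=> z; rewrite -ball_normE /ball_ /= -[_ < _]/(`|a - z| < e%:C) nrmE ltcR nrmBC; apply: eA.
Qed.

Lemma openCP (A : set C) : open A <->
  forall a, A a -> exists2 e : R, 0 < e & forall z, nrm (z - a) < e -> A z.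
Proof.
rewrite openE; split => [h a Aa|h a Aa]; first by apply/nbhsCP; exact: h.
by apply/nbhsCP; exact: h.
Qed.

Lemma closureCP (A : set C) a : closure A a <->
  forall e : R, 0 < e -> exists2 z, A z & nrm (z - a) < e.
Proof.
split=> [h e e0|h B /nbhsCP[e e0 eB]].
  have /h[z [Az /= za]] : nbhs a [set z | nrm (z - a) < e] by apply/nbhsCP; exists e.
  by exists z.
by have [z Az za] := h e e0; exists z; split => //; exact: eB.
Qed.

Lemma closedCP (A : set C) : closed A ->
  forall a, ~ A a -> exists2 e : R, 0 < e & forall z, A z -> e <= nrm (z - a).
Proof.
move=> /closed_openC/openCP h a /h[e e0 ea]; exists e => // z Az.
by rewrite leNgt; apply/negP => /ea.
Qed.

Lemma cvgRP (T : Type) (F : set_system T) {FF : Filter F} (f : T -> R) (l : R) :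
  (forall e : R, 0 < e -> \forall x \near F, `|f x - l| < e) ->
  f x @[x --> F] --> l.
Proof.
by move=> h; apply/cvgrPdist_lt => e /h; apply: filterS => x; rewrite distrC.
Qed.

Lemma lipschitz_continuousCR (f : C -> R) :
  (forall x y, `|f x - f y| <= nrm (x - y)) -> continuous f.
Proof.
move=> fL a; apply: (@cvgRP C (nbhs a) _ f (f a)) => e e0; apply/nbhsCP; exists e => // z.
exact: le_lt_trans (fL _ _).
Qed.

Lemma nrm_continuous : continuous (nrm : C -> R).
Proof.
apply: lipschitz_continuousCR => x y.
by rewrite ler_norml lerNl opprB nrm_sub_ge nrmBC nrm_sub_ge.
Qed.

Lemma Re_continuous : continuous (cRe : C -> R).
Proof.
by apply: lipschitz_continuousCR => x y; rewrite -ReN -ReD Re_le_nrm.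
Qed.

Lemma Im_continuous : continuous (cIm : C -> R).
Proof.
by apply: lipschitz_continuousCR => x y; rewrite -ImN -ImD Im_le_nrm.
Qed.

Lemma cvgCP (T : Type) (F : set_system T) {FF : Filter F} (f : T -> C) (l : C) :
  (f x @[x --> F] --> l) <->
  (forall e : R, 0 < e -> \forall x \near F, nrm (f x - l) < e).
Proof.
split => [h e e0|h A /nbhsCP[e e0 eA]].
  by apply: (h [set z | nrm (z - l) < e]); apply/nbhsCP; exists e.
by apply: filterS (h e e0) => x; exact: eA.
Qed.

Lemma cvg_complex (T : Type) (F : set_system T) {FF : Filter F} (f g : T -> R) (l m : R) :
  f x @[x --> F] --> l -> g x @[x --> F] --> m ->
  (f x +i* g x : C) @[x --> F] --> (l +i* m : C).
Proof.
move=> /cvgrPdist_lt fl /cvgrPdist_lt gm.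
apply/cvgCP => e e0; have e20 : 0 < e / 2 by rewrite divr_gt0.
apply: filterS2 (fl _ e20) (gm _ e20) => x /= h1 h2.
apply: le_lt_trans (nrm_le_ReIm _) _ => /=.
by rewrite [e]splitr ltrD// distrC.
Qed.

Lemma real_complex_continuous : continuous (fun r => r%:C : C).
Proof. by move=> r; apply: cvg_complex; [exact: cvg_id|exact: cvg_cst]. Qed.

Lemma conj_continuous : continuous (fun z : C => z^*).
Proof.
have -> : (fun z : C => z^*) = (fun z => cRe z -i* cIm z) by apply/funext => -[].
move=> z; apply: (@cvg_complex _ (nbhs z) _ cRe (fun w => - cIm w)).
  exact: Re_continuous.
by apply: cvgN; exact: Im_continuous.
Qed.

Lemma complex_pair_continuous : continuous (fun w : R * R => w.1 +i* w.2 : C).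
Proof. by move=> w; apply: cvg_complex; [exact: cvg_fst|exact: cvg_snd]. Qed.

Lemma horner_continuousC (p : {poly C}) : continuous (horner p).
Proof.
elim/poly_ind: p => [|p c IHp].
  rewrite (_ : horner 0 = fun=> 0); first exact: cont_cst.
  by apply/funext => x; rewrite horner0.
rewrite (_ : horner _ = fun x => p.[x] * x + c); last first.
  by apply/funext => x; rewrite hornerMXaddC.
apply: contD; last exact: cont_cst.
by apply: contM; [exact: IHp|move=> z; exact: cvg_id].
Qed.

Definition bddC (A : set C) := exists2 M : R, 0 < M & forall z, A z -> nrm z <= M.

Lemma bounded_setCP (A : set C) : bounded_set A <-> bddC A.
Proof.
split => [[M [Mreal h]]|[M M0 h]].
- have M1 : M < (`|cRe M| + 1)%:C.
    rewrite ltcE /=; have /RIm_real -/(@complexI R) -> := Mreal.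
    by rewrite eqxx /= (le_lt_trans (ler_norm _))// ltrDl.
  exists (`|cRe M| + 1); first by rewrite ltr_wpDl.
  move=> z Az; have : (nrm z)%:C <= (`|cRe M| + 1)%:C := h _ M1 z Az.
  by rewrite lecR.
- exists M%:C; split; first by rewrite complex_real.
  move=> x Mx z Az; apply: le_trans (ltW Mx); rewrite -[`|_|]/(nrm z)%:C lecR.
  exact: h.
Qed.

Lemma bdd_closed_compact (A : set C) : bddC A -> closed A -> compact A.
Proof.
move=> [M M0 AM] cA.
pose f (w : R * R) : C := w.1 +i* w.2.
apply: (@subclosed_compact _ A (f @` (`[(- M), M]%classic `*` `[(- M), M]%classic))) => //.
- apply: continuous_compact; last by apply: compact_setX; exact: segment_compact.
  by apply: continuous_subspaceT; exact: complex_pair_continuous.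
- move=> [x y] /AM Az; exists (x, y) => //=; rewrite !in_itv /= -!ler_norml; split.
    exact: le_trans (Re_le_nrm (x +i* y)) Az.
  exact: le_trans (Im_le_nrm (x +i* y)) Az.
Qed.

Lemma C_hausdorff : hausdorff_space C. Proof. exact: norm_hausdorff. Qed.

Lemma compact_min (A : set C) (f : C -> R) : compact A -> A !=set0 -> continuous f ->
  exists2 a, A a & forall z, A z -> f a <= f z.
Proof.
move=> cA A0 cf; have [|a] := @compact_EVT_min _ R f A A0 cA.
  exact: continuous_subspaceT.
by rewrite inE => Aa h; exists a => // z Az; apply: h; rewrite inE.
Qed.

Lemma compact_bdd (A : set C) : compact A -> bddC A.
Proof.
move=> cA; have [->|A0] := eqVneq A set0; first by exists 1.
have /set0P A0' := A0.
have [|a _ h] := @compact_EVT_max _ R nrm A A0' cA.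
  by apply: continuous_subspaceT; exact: nrm_continuous.
exists (nrm a + 1); first by rewrite ltr_wpDl ?nrm_ge0.
by move=> z Az; rewrite ler_wpDr// h// inE.
Qed.

End ComplexTopology.

(** * Nonvanishing maps of the plane *)

Section NoRetraction.
Context {R : realType}.
Local Notation C := R[i].

Definition cis (t : R) : C := cos t +i* sin t.

Lemma cis_continuous : continuous cis.
Proof.
move=> t; apply: (@cvg_complex _ _ (nbhs t) _ cos sin).
  exact: continuous_cos.
exact: continuous_sin.
Qed.

Lemma nrm_cis t : nrm (cis t) = 1.
Proof. by rewrite /cis /Normc.normc cos2Dsin2 sqrtr1. Qed.

Lemma cisD s t : cis (s + t) = cis s * cis t.
Proof.
by apply/eqP; rewrite eq_complex /= cosD sinD eqxx /= addrC.
Qed.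

Lemma cis0 : cis 0 = 1. Proof. by rewrite /cis cos0 sin0. Qed.

Lemma cisDpi t : cis (t + pi) = - cis t.
Proof. by rewrite /cis (cosDpi t) (sinDpi t). Qed.

Lemma cisD2pi t : cis (t + pi *+ 2) = cis t.
Proof. by rewrite mulr2n addrA !cisDpi opprK. Qed.

Lemma cis_sum (I : Type) (s : seq I) (F : I -> R) :
  cis (\sum_(i <- s) F i) = \prod_(i <- s) cis (F i).
Proof.
elim: s => [|i s IHs]; first by rewrite !big_nil cis0.
by rewrite !big_cons cisD IHs.
Qed.

Lemma polar_atan (w : C) : 0 < cRe w -> w = (nrm w)%:C * cis (atan (cIm w / cRe w)).
Proof.
case: w => a b /= a0; rewrite /cis /Normc.normc.
have s0 : 0 < Num.sqrt (1 + (b / a) ^+ 2) by rewrite sqrtr_gt0 ltr_wpDr ?sqr_ge0.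
have -> : sin (atan (b / a)) = (b / a) * cos (atan (b / a)).
  rewrite -{2}(atanK (b / a)) /tan mulfVK// gt_eqF//.
  by rewrite cos_atan invr_gt0.
rewrite cos_atan.
have -> : Num.sqrt (a ^+ 2 + b ^+ 2) = a * Num.sqrt (1 + (b / a) ^+ 2).
  rewrite -{2}(ger0_norm (ltW a0)) -sqrtr_sqr -sqrtrM ?sqr_ge0//.
  by congr Num.sqrt; field; rewrite gt_eqF.
apply/eqP; rewrite eq_complex /=; apply/andP; split; apply/eqP; field;
  by rewrite ?gt_eqF.
Qed.

(** A continuous angle of a fixed direction cannot grow by a full turn: on the way it passes
    [u 0 + pi], where [cis] has changed sign. *)
Lemma cis_lift_contra (u : R -> R) (c : C) : continuous u ->
  (forall t, cis (u t) = c) -> u (pi *+ 2) = u 0 + pi *+ 2 -> False.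
Proof.
move=> cu uc u2.
have p0 : 0 < pi :> R := pi_gt0 R.
have [|||t _ ut] := @IVT R u 0 (pi *+ 2) (u 0 + pi).
- by rewrite mulrn_wge0// ltW.
- exact: continuous_subspaceT.
- have le02 : u 0 <= u 0 + pi *+ 2 by rewrite lerDl mulrn_wge0// ltW.
  by rewrite u2 min_l// max_r// mulr2n; apply/andP; split; lra.
have := uc t; rewrite ut cisDpi uc => /eqP; rewrite -subr_eq0 -opprD oppr_eq0.
rewrite -mulr2n mulrn_eq0 /= => /eqP c0.
have := nrm_cis (u 0); rewrite uc c0 Normc.normc0 => /eqP.
by rewrite eq_sym oner_eq0.
Qed.

(** For [w] within [d] of [z] the ratio [F w / F z] then lies in the open disc of radius 1 about 1,
    hence in the right half-plane, where [atan] provides a continuous argument. *)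
Lemma uniform_small_variation (F : C -> C) (K : set C) : continuous F ->
  (forall z, F z != 0) -> compact K ->
  exists2 d : R, 0 < d & forall z w, K z -> nrm (w - z) < d -> nrm (F w - F z) < nrm (F z).
Proof.
move=> cF F0 cK.
pose P (d : R) z := forall w, nrm (w - z) < d -> nrm (F w - F z) < nrm (F z).
have h : \forall d \near 0^'+, K `<=` P d.
  move/compact_near_coveringP : (cK); apply.
  move=> z Kz; have e0 : 0 < nrm (F z) / 4 by rewrite divr_gt0// nrm_gt0.
  have /cvgCP/(_ _ e0)/nbhsCP[d d0 dF] : F x @[x --> z] --> F z by exact: cF.
  exists ([set z' | nrm (z' - z) < d / 2], [set t | t < d / 2]) => /=.
    split; first by apply/nbhsCP; exists (d / 2) => //; rewrite divr_gt0.
    by apply: nbhs_right_lt; rewrite divr_gt0.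
  move=> [z' t] /= [zz' td] w wz'.
  have h1 : nrm (F w - F z) < nrm (F z) / 4.
    apply: dF; apply: le_lt_trans (nrm_dist_tri z' _ _) _.
    by rewrite [d]splitr ltrD// (lt_trans wz').
  have h2 : nrm (F z' - F z) < nrm (F z) / 4.
    by apply: dF; apply: lt_trans zz' _; rewrite ltr_pdivrMr// ltr_pMr// ltr1n.
  have h3 := nrm_dist_tri (F z) (F w) (F z').
  have h4 := nrm_sub_ge (F z) (F z'); rewrite nrmBC in h4.
  rewrite (nrmBC (F z)) in h3; lra.
have [d [hd d0]] : exists d, K `<=` P d /\ 0 < d.
  by apply: (@filter_ex _ (0^'+)); apply: filterI; [exact: h|exact: nbhs_right_gt].
by exists d => // z w Kz; exact: hd.
Qed.

(** On the circle of radius [M], [F] is [F 0] times a product of ratios along the radius, each with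
    a continuous argument periodic in [t]. Since [F] is the identity there, [t] minus the sum of
    these arguments is a continuous angle of a constant, yet it grows by a full turn. *)
Lemma no_retraction0 (F : C -> C) (M : R) : continuous F -> (forall z, F z != 0) ->
  0 < M -> (forall z, nrm z = M -> F z = z) -> False.
Proof.
move=> cF F0 M0 FM.
have cB : compact [set z : C | nrm z <= M].
  apply: bdd_closed_compact; first by exists M.
  apply: (@closed_comp _ _ nrm [set x : R | x <= M]); last exact: closed_le.
  by move=> z _; exact: nrm_continuous.
have [d d0 dF] := uniform_small_variation cF F0 cB.
pose n := (Num.truncn (M / d)).+1.
have nM : M / n%:R < d.
  by rewrite ltr_pdivrMr ?ltr0n// mulrC -ltr_pdivrMr// truncnS_gt.
pose pt k (t : R) : C := (k%:R * (M / n%:R))%:C * cis t.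
have ptnrm k t : nrm (pt k t) = k%:R * (M / n%:R).
  rewrite nrmM nrm_cis mulr1 nrm_real ger0_norm// mulr_ge0// divr_ge0//.
  exact: ltW.
pose r k t := F (pt k.+1 t) / F (pt k t).
have rRe k t : (k < n)%N -> 0 < cRe (r k t).
  move=> kn.
  have h : nrm (r k t - 1) < 1.
    have -> : r k t - 1 = (F (pt k.+1 t) - F (pt k t)) / F (pt k t).
      by rewrite /r mulrBl divff.
    rewrite nrmM nrmV ltr_pdivrMr ?nrm_gt0// mul1r; apply: dF => /=.
      rewrite ptnrm mulrCA -[leRHS]mulr1 ler_pM2l// ler_pdivrMr ?ltr0n//.
      by rewrite mul1r ler_nat ltnW.
    rewrite /pt -mulrBl -rmorphB -mulrBl -natrB// subSnn mul1r nrmM nrm_cis mulr1.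
    by rewrite nrm_real ger0_norm// divr_ge0// ltW.
  have := le_lt_trans (Re_le_nrm _) h.
  rewrite ReD ReN /= => /ltr_normlP[]; lra.
pose A t := \sum_(k < n) atan (cIm (r k t) / cRe (r k t)).
have cpt k : continuous (pt k).
  by apply: contM; [exact: cont_cst|exact: cis_continuous].
have cr k : continuous (r k).
  apply: contM; first exact: (cont_comp (cpt _) cF).
  by apply: contV => [x|]; [exact: F0|exact: (cont_comp (cpt _) cF)].
have cA : continuous A.
  apply: cont_sum => k; apply: (@cont_comp _ _ _ _ atan); last exact: continuous_atan.
  apply: contM; first exact: (cont_comp (cr _) (@Im_continuous R)).
  apply: contV => [x|]; last exact: (cont_comp (cr _) (@Re_continuous R)).
  by rewrite gt_eqF// rRe.
have FE t : F (pt n t) = F 0 * (\prod_(k < n) (nrm (r k t))%:C) * cis (A t).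
  have tel m : F (pt m t) = F (pt 0%N t) * \prod_(k < m) r k t.
    elim: m => [|m IHm]; first by rewrite big_ord0 mulr1.
    by rewrite big_ord_recr /= mulrA -IHm /r mulrCA divff// mulr1.
  rewrite tel {1}/pt !mul0r -mulrA; congr (_ * _).
  rewrite cis_sum -big_split /=; apply: eq_bigr => k _.
  by apply: polar_atan; exact: rRe.
have FM' t : F (pt n t) = M%:C * cis t.
  rewrite FM; first by rewrite /pt (mulrC n%:R) mulfVK// pnatr_eq0.
  by rewrite ptnrm (mulrC n%:R) mulfVK// pnatr_eq0.
(* Taking moduli identifies [M] with [nrm (F 0)] times the product of the moduli of the ratios, so
   after division only directions remain. *)
pose c := F 0 / (nrm (F 0))%:C.
have FMc t : cis t = c * cis (A t).
  have nFM := congr1 nrm (FE t).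
  rewrite -rmorph_prod /= !nrmM nrm_cis mulr1 FM' nrmM nrm_cis mulr1 !nrm_real in nFM.
  rewrite (gtr0_norm M0) ger0_norm in nFM; last by apply: prodr_ge0 => k _; exact: nrm_ge0.
  have /(congr1 (fun x => x / M%:C)) := FM' t; rewrite mulrAC divff ?mul1r; last first.
    by rewrite -nrm_eq0 nrm_real normr_eq0 gt_eqF.
  move=> <-; rewrite FE -rmorph_prod /= [in M%:C]nFM rmorphM /= /c.
  set P := (\prod_(k < n) _)%:C.
  have P0 : P != 0.
    have P0 : \prod_(k < n) nrm (r k t) != 0.
      by apply/prodf_neq0 => k _; rewrite nrm_eq0 mulf_neq0// invr_eq0.
    by rewrite -nrm_eq0 nrm_real normr_eq0.
  have nF0 : (nrm (F 0))%:C != 0 by rewrite -nrm_eq0 nrm_real normr_eq0 nrm_eq0.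
  by field; rewrite P0 nF0.
have cu : continuous (fun t => t - A t).
  by apply: contD; [move=> x; exact: cvg_id|exact: contN].
apply: (cis_lift_contra cu (c := c)).
- by move=> t; rewrite cisD FMc -mulrA -cisD subrr cis0 mulr1.
- have -> : A (pi *+ 2) = A 0.
    apply: eq_bigr => k _; rewrite /r /pt.
    by rewrite -[pi *+ 2]add0r cisD2pi.
  by rewrite sub0r addrC.
Qed.

Lemma no_retraction (F : C -> C) (a : C) (M : R) : continuous F -> (forall z, F z != 0) ->
  (forall z, M <= nrm (z - a) -> F z = z - a) -> False.
Proof.
move=> cF F0 FM.
apply: (@no_retraction0 (fun z => F (z + a)) (Num.max M 1)).
- by apply: (cont_comp _ cF); apply: contD; [move=> x; exact: cvg_id|exact: cont_cst].
- by move=> z; exact: F0.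
- by rewrite lt_max ltr01 orbT.
- by move=> z zM; rewrite FM addrK// zM le_max lexx.
Qed.

End NoRetraction.

(** * Jordan curves *)

Section JordanCurve.
Context {R : realType}.
Local Notation C := R[i].
Implicit Types (L D : set C) (a b z w u : C).

Lemma unit_circleE z : unit_circle z <-> nrm z = 1.
Proof. by split => [[]|h] //; rewrite /unit_circle /= -[`|z|]/(nrm z)%:C h. Qed.

Lemma unit_circle_compact : compact (@unit_circle R).
Proof.
apply: bdd_closed_compact; first by exists 1 => // z /unit_circleE ->.
rewrite (_ : unit_circle = nrm @^-1` [set x : R | x = 1]); last first.
  by apply/seteqP; split => z /unit_circleE.
by apply: (@closed_comp _ _ nrm) => [z _|]; [exact: nrm_continuous|exact: closed_eq].
Qed.

Lemma jordan_compact L : jordan_curve L -> compact L.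
Proof. by move=> [f [cf _ ->]]; apply: continuous_compact => //; exact: unit_circle_compact. Qed.

Lemma compact_closedC (A : set C) : compact A -> closed A.
Proof. by apply: compact_closed; exact: C_hausdorff. Qed.

(** [(u0 + u) / (u0 - u)] is the Cayley transform, which sends the unit circle without [u0] into the
    imaginary axis. It is injective as a homography, and [cIm] loses nothing because the real part
    is 0. *)
Lemma stereographic_inj (u0 u v : C) : nrm u0 = 1 -> nrm u = 1 -> nrm v = 1 ->
  u != u0 -> v != u0 ->
  cIm ((u0 + u) / (u0 - u)) = cIm ((u0 + v) / (u0 - v)) -> u = v.
Proof.
move=> n0 nu nv uu0 vu0 huv.
have Re0 w : nrm w = 1 -> cRe ((u0 + w) / (u0 - w)) = 0.
  move=> nw; have := sqr_nrm u0; have := sqr_nrm w; rewrite n0 nw.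
  case: u0 {n0 uu0 vu0 huv} => a b; case: w {nw} => c d /= h1 h2.
  have -> : (a + c) * ((a - c) / ((a - c) ^+ 2 + (b - d) ^+ 2)) -
    (b + d) * - ((b - d) / ((a - c) ^+ 2 + (b - d) ^+ 2)) =
    (a ^+ 2 + b ^+ 2 - (c ^+ 2 + d ^+ 2)) / ((a - c) ^+ 2 + (b - d) ^+ 2) by ring.
  by rewrite -h1 -h2 subrr mul0r.
have E : (u0 + u) / (u0 - u) = (u0 + v) / (u0 - v).
  by apply/eqP; rewrite eq_complex !Re0// huv !eqxx.
have d1 : u0 - u != 0 by rewrite subr_eq0 eq_sym.
have d2 : u0 - v != 0 by rewrite subr_eq0 eq_sym.
have u0n : u0 != 0 by rewrite -nrm_eq0 n0 oner_eq0.
have : (u0 + u) * (u0 - v) = (u0 + v) * (u0 - u).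
  by rewrite -[u0 + u](divfK d1) E; field.
move/eqP; rewrite -subr_eq0.
have -> : (u0 + u) * (u0 - v) - (u0 + v) * (u0 - u) = 2%:R * u0 * (u - v) by ring.
by rewrite !mulf_eq0 pnatr_eq0 /= (negPf u0n) /= subr_eq0 => /eqP.
Qed.

(** One-dimensional Borsuk-Ulam: [psi t - psi (t + pi)] changes sign over half a turn. *)
Lemma no_circle_embedding (psi : R -> R) : continuous psi ->
  (forall t, psi (t + pi *+ 2) = psi t) -> exists t, psi t = psi (t + pi).
Proof.
move=> cpsi per; pose k t := psi t - psi (t + pi).
have ck : continuous k.
  apply: contD => //; apply: contN; apply: (cont_comp _ cpsi).
  by apply: contD; [move=> x; exact: cvg_id|exact: cont_cst].
have kpi : k pi = - k 0.
  by rewrite /k opprB add0r -mulr2n -[pi *+ 2]add0r per.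
have [|||t _ kt] := @IVT R k 0 pi 0.
- exact: pi_ge0.
- exact: continuous_subspaceT.
- rewrite kpi; have [k0|k0] := leP 0 (k 0).
    by rewrite min_r ?max_l; lra.
  by rewrite min_l ?max_r; lra.
- by exists t; apply/eqP; rewrite -subr_eq0 -/(k t) kt.
Qed.

(** A disc inside [L] would embed into the unit circle by the inverse of the parametrization. The
    image of a smaller circle around [a] misses the image of [a], so stereographic projection from
    there would embed this circle into the line, against Borsuk-Ulam. *)
Lemma jordan_no_interior L a (r : R) : jordan_curve L -> 0 < r ->
  exists2 z, nrm (z - a) < r & ~ L z.
Proof.
move=> [f [cf finj LE]] r0; apply: contrapT => noz.
have BL z : nrm (z - a) < r -> L z.
  by move=> za; apply: contrapT => Lz; apply: noz; exists z.
have /choice[g gP] : forall z, exists u, L z -> unit_circle u /\ f u = z.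
  move=> z; have [|Lz] := pselect (L z); last by exists 0.
  by rewrite LE => -[u cu uz]; exists u.
(* Continuity of the inverse comes from compactness: the parameters at distance at least [e] from
   [g z] have a compact image missing [z], hence at positive distance from it. *)
have cg z : nrm (z - a) < r -> g x @[x --> z] --> g z.
  move=> za; apply: (proj2 (@cvgCP R C (nbhs z) _ g (g z))) => e e0.
  pose E := unit_circle `&` [set u | e <= nrm (u - g z)].
  have cE : compact (f @` E).
    apply: continuous_compact.
      by apply: (continuous_subspaceW _ cf) => u [].
    apply: (subclosed_compact _ unit_circle_compact) => [|u []//].
    apply: closedI; first exact: compact_closedC unit_circle_compact.
    apply: (@closed_comp _ _ (fun u => nrm (u - g z)) [set x : R | e <= x]).
      move=> u _; apply: cont_comp; last exact: nrm_continuous.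
      by apply: contD; [move=> x; exact: cvg_id|exact: cont_cst].
    exact: closed_ge.
  have [d d0 dE] : exists2 d : R, 0 < d & forall w, (f @` E) w -> d <= nrm (w - z).
    apply: (closedCP (compact_closedC cE)) => -[u [cu /= ue] uz].
    have [cgz fgz] := gP _ (BL _ za).
    have ugz : u = g z by apply: finj; rewrite ?inE ?fgz.
    by move: ue; rewrite ugz subrr Normc.normc0 leNgt e0.
  apply/nbhsCP; exists (Num.min d (r - nrm (z - a))).
    by rewrite lt_min d0 subr_gt0.
  move=> w; rewrite lt_min => /andP[wd wr] /=; rewrite ltNge; apply/negP => ew.
  have Bw : nrm (w - a) < r.
    by apply: le_lt_trans (nrm_dist_tri z _ _) _; rewrite -ltrBrDr.
  have [cgw fgw] := gP _ (BL _ Bw).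
  by move: wd; rewrite ltNge => /negP; apply; apply: dE; exists (g w).
pose G t := g (a + (r / 2)%:C * cis t).
have r20 : 0 < r / 2 by rewrite divr_gt0.
have GB t : nrm (a + (r / 2)%:C * cis t - a) < r.
  rewrite addrC addKr nrmM nrm_cis mulr1 nrm_real gtr0_norm//.
  by rewrite ltr_pdivrMr// ltr_pMr// ltr1n.
have cG : continuous G.
  move=> t; apply: (@continuous_comp _ _ _ (fun t => a + (r / 2)%:C * cis t) g).
    apply: contD; first exact: cont_cst.
    by apply: contM; [exact: cont_cst|exact: cis_continuous].
  by apply: cg; exact: GB.
have aB : nrm (a - a) < r by rewrite subrr Normc.normc0.
have G1 t : nrm (G t) = 1 by apply/unit_circleE; have [] := gP _ (BL _ (GB t)).
have g1 : nrm (g a) = 1 by apply/unit_circleE; have [] := gP _ (BL _ aB).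
have ginj z w : nrm (z - a) < r -> nrm (w - a) < r -> g z = g w -> z = w.
  by move=> /BL/gP[_ fz] /BL/gP[_ fw] gzw; rewrite -[LHS]fz -[RHS]fw gzw.
have Gg t : G t != g a.
  apply/eqP => /(ginj _ _ (GB t) aB)/eqP; rewrite -subr_eq0 addrC addKr.
  by rewrite -nrm_eq0 nrmM nrm_cis mulr1 nrm_real normr_eq0 gt_eqF.
pose psi t := cIm ((g a + G t) / (g a - G t)).
have cpsi : continuous psi.
  apply: cont_comp; last exact: Im_continuous.
  apply: contM; first by apply: contD; [exact: cont_cst|exact: cG].
  apply: contV; first by move=> t; rewrite subr_eq0 eq_sym.
  by apply: contD; [exact: cont_cst|apply: contN; exact: cG].
have [|t] := no_circle_embedding cpsi.
  by move=> t; rewrite /psi /G cisD2pi.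
move=> /(stereographic_inj g1 (G1 _) (G1 _) (Gg _) (Gg _)) /(ginj _ _ (GB _) (GB _)).
move=> /addrI /mulfI; rewrite cisDpi => h.
have /eqP : cis t = - cis t.
  by apply: h; rewrite -nrm_eq0 nrm_real normr_eq0 gt_eqF.
rewrite -subr_eq0 opprK -mulr2n mulrn_eq0 /= => /eqP c0.
by have /eqP := nrm_cis t; rewrite c0 Normc.normc0 eq_sym oner_eq0.
Qed.

End JordanCurve.

(** * Interior and exterior of a Jordan curve *)

Section JordanInterior.
Context {R : realType}.
Local Notation C := R[i].
Implicit Types (L D : set C) (a b z w u : C).

Lemma itv_image_connected (f : R -> C) (i : interval R) : continuous f ->
  connected (f @` [set` i]).
Proof.
move=> cf; apply: connected_continuous_connected; last exact: continuous_subspaceT.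
by apply/connected_intervalP; exact: interval_is_interval.
Qed.

Lemma segment_map_continuous a b : continuous (fun t : R => a + t%:C * b).
Proof.
apply: contD; first exact: cont_cst.
by apply: contM; [exact: real_complex_continuous|exact: cont_cst].
Qed.

Lemma component_near L a : closed L -> ~ L a ->
  exists2 e : R, 0 < e & forall b, nrm (b - a) < e ->
    ~ L b /\ connected_component (~` L) b = connected_component (~` L) a.
Proof.
move=> cL La; have [e e0 eL] := closedCP cL La.
have eL' b : nrm (b - a) < e -> ~ L b by move=> ba /eL; rewrite leNgt ba.
exists e => // b ba; split; first exact: eL'.
apply/esym/same_connected_component.
apply: (connected_component_max _ _ (itv_image_connected (i := `[0, 1]) (@segment_map_continuous a (b - a)))).
- by exists 0; rewrite ?mul0r ?addr0//= in_itv /= lexx ler01.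
- move=> _ [t /= + <-]; rewrite in_itv /= => /andP[t0 t1]; apply: eL'.
  rewrite addrC addKr nrmM nrm_real ger0_norm//; apply: le_lt_trans ba.
  by rewrite ler_piMl// nrm_ge0.
- by exists 1; rewrite ?mul1r ?subrKC//= in_itv /= lexx ler01.
Qed.

Lemma jordan_interior_near L a : closed L -> ~ L a ->
  exists2 e : R, 0 < e & forall b, nrm (b - a) < e -> jordan_interior L b <-> jordan_interior L a.
Proof.
move=> cL La; have [e e0 eL] := component_near cL La; exists e => // b /eL[Lb cb].
by rewrite /jordan_interior /= cb; split=> -[].
Qed.

Lemma jordan_interior_open L : closed L -> open (jordan_interior L).
Proof.
move=> cL; apply/openCP => a Da; have [La _] := Da.
have [e e0 eD] := jordan_interior_near cL La; exists e => // z /eD h.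
exact/h.
Qed.

(** From a point of modulus greater than [M] the outward ray never meets [L], so the component of
    that point is unbounded. *)
Lemma jordan_interior_bdd L (M : R) : 0 <= M -> (forall z, L z -> nrm z <= M) ->
  forall z, jordan_interior L z -> nrm z <= M.
Proof.
move=> M0 LM z [Lz /bounded_setCP[B B0 hB]]; rewrite leNgt; apply/negP => Mz.
have z0 : 0 < nrm z by exact: le_lt_trans Mz.
have rayE (t : R) : 0 <= t -> nrm (z + t%:C * z) = nrm z + t * nrm z.
  move=> t0; rewrite -[X in X + _]mul1r -mulrDl nrmM -(rmorph1 (real_complex R)).
  by rewrite -rmorphD /= nrm_real ger0_norm ?addr_ge0// mulrDl mul1r.
have /(_ (z + (B / nrm z)%:C * z)) := hB.
have Bz : 0 <= B / nrm z by rewrite divr_ge0// ltW.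
rewrite (rayE _ Bz) divfK ?gt_eqF// => h.
suff /h : connected_component (~` L) z (z + (B / nrm z)%:C * z) by lra.
apply: (connected_component_max _ _
  (itv_image_connected (i := `[0, +oo[) (@segment_map_continuous z z))).
- by exists 0; rewrite ?mul0r ?addr0//= in_itv /= lexx.
- move=> _ [t /= + <-]; rewrite in_itv /= andbT => t0 /LM; rewrite rayE//.
  by rewrite leNgt (lt_le_trans Mz)// lerDl mulr_ge0// ltW.
- by exists (B / nrm z) => //=; rewrite in_itv /= andbT.
Qed.

Lemma closure_jordan_interior L z : closed L -> closure (jordan_interior L) z ->
  L z \/ jordan_interior L z.
Proof.
move=> cL /closureCP cz; have [|Lz] := pselect (L z); [by left|right].
have [e e0 eD] := jordan_interior_near cL Lz.
by have [w Dw /eD h] := cz e e0; exact/h.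
Qed.

(* [Q] is locally constant off the closure of the Jordan interior, which has a
   connected complement: the exterior is dense in it, as [L] has no interior. *)
Lemma exterior_ind L (Q : C -> Prop) (M : R) :
  jordan_curve L ->
  (forall a, ~ closure (jordan_interior L) a ->
    exists2 e : R, 0 < e & forall b, nrm (b - a) < e -> (Q b <-> Q a)) ->
  (forall a, M <= nrm a -> Q a) ->
  forall a, ~ closure (jordan_interior L) a -> Q a.
Proof.
move=> jL Qloc Qinf; set K := closure _.
have cL : closed L by apply: compact_closedC; exact: jordan_compact.
(* The component of [a] is unbounded, so it contains a far point, where [Q] holds. Both [Q] and its
   negation are open conditions on it, and connectedness carries [Q] back to [a]. *)
have ext a : ~ L a -> ~ jordan_interior L a -> Q a.
  move=> La Da; set X := connected_component (~` L) a.
  have XK b : X b -> ~ K b.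
    move=> Xb Kb; have Lb : ~ L b := connected_component_sub Xb.
    have [//|[_]] := closure_jordan_interior cL Kb.
    by rewrite -(same_connected_component Xb) => bX; apply: Da.
  have Xa : X a by exact: connected_component_refl.
  have unbX : ~ bddC X by move/bounded_setCP => bX; apply: Da.
  have [b Xb Mb] : exists2 b, X b & M <= nrm b.
    apply: contrapT => nob; apply: unbX; exists (Num.max M 1).
      by rewrite lt_max ltr01 orbT.
    move=> z Xz; rewrite le_max; apply/orP; left; rewrite leNgt; apply/negP => Mz.
    by apply: nob; exists z => //; exact: ltW.
  have cX : connected X by exact: component_connected.
  have oQ (P : Prop -> Prop) : open [set c | ~ K c /\ P (Q c)].
    apply/openCP => c [Kc Pc]; have [e e0 eQ] := Qloc c Kc.
    have [e' e'0 eK] := closedCP (@closed_closure _ _) Kc.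
    exists (Num.min e e'); first by rewrite lt_min e0.
    move=> z; rewrite lt_min => /andP[ze ze']; split.
      by move=> /eK; rewrite leNgt ze'.
    by rewrite (propext (eQ z ze)).
  suff XQ : X `&` [set c | ~ K c /\ Q c] = X by move: Xa; rewrite -XQ => -[_ []].
  apply: cX.
  - by exists b; split => //; split; [exact: XK|exact: Qinf].
  - by exists [set c | ~ K c /\ Q c] => //; exact: (oQ id).
  - exists (~` [set c | ~ K c /\ ~ Q c]); first by apply: open_closedC; exact: (oQ not).
    apply/seteqP; split => c [Xc].
      by move=> [Kc Qc]; split => // -[].
    move=> h; split => //; split; first exact: XK.
    by apply: contrapT => Qc; apply: h; split => //; exact: XK.
move=> a Ka.
(* The point [a] may lie on [L]; as [L] contains no disc, a nearby point off [L] decides [Q a]. *)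
have [e e0 eQ] := Qloc a Ka.
have [e' e'0 eK] := closedCP (@closed_closure _ _) Ka.
have [|z za Lz] := @jordan_no_interior R L a (Num.min e e') jL.
  by rewrite lt_min e0.
move: za; rewrite lt_min => /andP[ze ze'].
apply/(eQ z ze); apply: ext => // Dz.
by have := eK z (subset_closure Dz); rewrite leNgt ze'.
Qed.

End JordanInterior.

(** * Polynomial hulls of unions *)

Section Cutoff.
Context {R : realType}.
Local Notation C := R[i].
Implicit Types (A : set C) (z w : C).

Lemma common_positive_bound (I : finType) (P : I -> R -> Prop) :
  (forall i d d', 0 < d' -> d' <= d -> P i d -> P i d') ->
  (forall i, exists2 d : R, 0 < d & P i d) ->
  exists2 d : R, 0 < d & forall i, P i d.
Proof.
move=> Pmono /(_ _)/cid2-/all_sig2[d d0 Pd].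
have d'0 : 0 < \big[Num.min/1]_i d i.
  by elim/big_ind: _ => // x y x0 y0; rewrite lt_min x0.
exists (\big[Num.min/1]_i d i) => // i; apply: Pmono (Pd i) => //.
exact: bigmin_le_cond.
Qed.

Definition set_dist A z : R := inf [set nrm (z - w) | w in A].

Lemma set_dist_le A z w : A w -> set_dist A z <= nrm (z - w).
Proof.
move=> Aw; apply: ge_inf; last by exists w.
by exists 0 => _ [v _ <-]; exact: nrm_ge0.
Qed.

Lemma set_dist_ge A z (c : R) : A !=set0 -> (forall w, A w -> c <= nrm (z - w)) ->
  c <= set_dist A z.
Proof.
move=> [w Aw] h; apply: lb_le_inf; first by exists (nrm (z - w)), w.
by move=> _ [v Av <-]; exact: h.
Qed.

Lemma set_dist_le_dist A z w : A !=set0 -> set_dist A z - set_dist A w <= nrm (z - w).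
Proof.
move=> A0; rewrite lerBlDr -lerBlDl; apply: set_dist_ge => // v Av; rewrite lerBlDl.
exact: le_trans (set_dist_le _ Av) (nrm_dist_tri _ _ _).
Qed.

(** Equal to 1 up to distance [d] from [A], to 0 from distance [2 * d] on, and linear in the
    distance in between. The Lipschitz constant [1 / d] is what the error estimate of the grid sum
    relies on. *)
Definition cutoff A (d : R) z : R := Num.max 0 (Num.min 1 (2 - set_dist A z / d)).

Lemma cutoff_ge0 A d z : 0 <= cutoff A d z.
Proof. by rewrite le_max lexx. Qed.

Lemma cutoff_le1 A d z : cutoff A d z <= 1.
Proof. by rewrite ge_max ler01 ge_min lexx. Qed.

Lemma cutoff_eq1 A d z w : 0 < d -> A w -> nrm (z - w) <= d -> cutoff A d z = 1.
Proof.
move=> d0 Aw zw; have h : set_dist A z / d <= 1.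
  by rewrite ler_pdivrMr// mul1r (le_trans (set_dist_le _ Aw)).
by rewrite /cutoff min_l ?max_r//; lra.
Qed.

Lemma cutoff_eq0 A d z : 0 < d -> A !=set0 -> (forall w, A w -> 2 * d <= nrm (z - w)) ->
  cutoff A d z = 0.
Proof.
move=> d0 A0 h; have h2 : 2 <= set_dist A z / d.
  by rewrite ler_pdivlMr//; exact: set_dist_ge.
by rewrite /cutoff max_l// ge_min; apply/orP; right; lra.
Qed.

Lemma cutoff_lipschitz A d z w : 0 < d -> A !=set0 ->
  `|cutoff A d z - cutoff A d w| <= nrm (z - w) / d.
Proof.
move=> d0 A0.
have clamp (s t c : R) : `|s - t| <= c ->
    `|Num.max 0 (Num.min 1 s) - Num.max 0 (Num.min 1 t)| <= c.
  by rewrite !ler_norml => /andP[h1 h2]; rewrite !maxEle !minEle;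
    do 4! case: ifPn; rewrite -?ltNge => *; apply/andP; split; lra.
apply: clamp; rewrite opprD addrACA subrr add0r opprK addrC -mulrBl normrM.
rewrite (gtr0_norm (x := d^-1)) ?invr_gt0// ler_pM2r ?invr_gt0//.
rewrite ler_norml lerNl opprB set_dist_le_dist//.
by rewrite nrmBC set_dist_le_dist.
Qed.

Lemma cutoff_continuous A d : 0 < d -> A !=set0 -> continuous (cutoff A d).
Proof.
move=> d0 A0 a; apply: (@cvgRP R C (nbhs a) _ (cutoff A d) (cutoff A d a)) => e e0.
apply/nbhsCP; exists (e * d); first by rewrite mulr_gt0.
move=> z za; apply: le_lt_trans (cutoff_lipschitz _ _ d0 A0) _.
by rewrite ltr_pdivrMr.
Qed.

Lemma disjoint_compact_dist (A B : set C) : compact A -> closed B -> A `&` B = set0 ->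
  exists2 d : R, 0 < d & forall z w, A z -> B w -> d <= nrm (z - w).
Proof.
move=> cA cB AB.
have [->|/set0P A0] := eqVneq A set0; first by exists 1.
have [->|/set0P B0] := eqVneq B set0; first by exists 1.
have cd : continuous (set_dist B).
  apply: lipschitz_continuousCR => x y.
  by rewrite ler_norml lerNl opprB set_dist_le_dist// nrmBC set_dist_le_dist.
have [a Aa amin] := compact_min cA A0 cd.
have nBa : ~ B a by move=> Ba; have : (A `&` B) a by []; rewrite AB.
have [e e0 eB] := closedCP cB nBa.
exists e => // z w Az Bw; apply: le_trans (set_dist_le _ Bw).
apply: le_trans (amin _ Az); apply: set_dist_ge => // v Bv.
by rewrite nrmBC eB.
Qed.

End Cutoff.

Section Nonvanishing.
Context {R : realType}.
Local Notation C := R[i].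
Implicit Types (a b z w : C).

Lemma add1_neq0 w : nrm w < 1 -> 1 + w != 0.
Proof.
move=> w1; apply: contraTneq w1 => /eqP; rewrite addrC addr_eq0 => /eqP ->.
by rewrite nrmN Normc.normc1 ltxx.
Qed.

(** A branch of log (z - a) near [K] would give such an [h] as the exponential of its product with
    [phi]. The value 1 where [phi] vanishes is what allows extensions from several islands to be
    multiplied. *)
Definition nonvanishing_ext (K : set C) (phi : C -> R) a := exists h : C -> C,
  [/\ continuous h, forall z, h z != 0, forall z, K z -> h z = z - a &
      forall z, phi z = 0 -> h z = 1].

(** The segment from 1 to a nonzero [s] with nonnegative real part misses 0, whereas the segment
    from 1 to [a] need not; hence the deformation to 1 is made on a square root. *)
Lemma sqrt_Re_ge0 a : exists2 s : C, s ^+ 2 = a & 0 <= cRe s.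
Proof.
have [h|h] := leP 0 (cRe (sqrtc a)); first by exists (sqrtc a) => //; exact: sqr_sqrtc.
by exists (- sqrtc a); rewrite ?sqrrN ?sqr_sqrtc// ReN oppr_ge0 ltW.
Qed.

Context (K : set C) (phi : C -> R).
Hypotheses (cphi : continuous phi) (phi01 : forall z, 0 <= phi z <= 1)
  (phi1 : forall z, K z -> phi z = 1).

(** [z - a = s ^+ 2 * (1 - z / a)] with [s ^+ 2 = - a]. Both [s] and the second factor are deformed
    to 1 linearly in [phi z]: the former along a segment missing 0, the latter within distance 1/2
    of 1. *)
Lemma nonvanishing_ext_far (B : R) a : 0 < B -> (forall z, phi z != 0 -> nrm z <= B) ->
  2 * B <= nrm a -> nonvanishing_ext K phi a.
Proof.
move=> B0 phiB aB; have [s sa s0] := sqrt_Re_ge0 (- a).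
have na0 : 0 < nrm a by apply: lt_le_trans aB; rewrite mulr_gt0.
have a0 : a != 0 by rewrite -nrm_gt0.
have cphiC : continuous (fun z => (phi z)%:C : C).
  exact: (cont_comp cphi (@real_complex_continuous R)).
exists (fun z => (1 + (phi z)%:C * (s - 1)) ^+ 2 * (1 + (phi z)%:C * (z * - a^-1))); split.
- have c1 : continuous (fun z : C => 1 + (phi z)%:C * (s - 1)).
    apply: contD; first exact: cont_cst.
    by apply: contM; [exact: cphiC|exact: cont_cst].
  apply: contM; first by apply: contM; exact: c1.
  apply: contD; first exact: cont_cst.
  apply: contM; first exact: cphiC.
  by apply: contM; [move=> z; exact: cvg_id|exact: cont_cst].
- move=> z; have /andP[p0 p1] := phi01 z.
  rewrite mulf_neq0 ?expf_neq0//.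
    apply/eqP => h; have /(congr1 (fun x => cRe x)) := h.
    rewrite mulrBr mulr1 !ReD ReN.
    have -> : cRe ((phi z)%:C * s) = phi z * cRe s by case: (s) => ? ? /=; rewrite mul0r subr0.
    move=> /= h1; have h2 : 0 <= phi z * cRe s by rewrite mulr_ge0.
    have h3 : phi z = 1 by lra.
    move: h; rewrite h3 mul1r subrKC => h; move: sa; rewrite h expr0n /= => /eqP.
    by rewrite eq_sym oppr_eq0 (negPf a0).
  apply: add1_neq0; rewrite !nrmM nrmN nrmV nrm_real ger0_norm//.
  have [->|pz0] := eqVneq (phi z) 0; first by rewrite mul0r.
  have := phiB z pz0 => zB; apply: (@le_lt_trans _ _ (1 * (1 / 2))); last by lra.
  rewrite ler_pM// ?mulr_ge0 ?nrm_ge0 ?invr_ge0 ?nrm_ge0// ler_pdivrMr//; lra.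
- by move=> z Kz; rewrite phi1// !mul1r subrKC sa; field.
- by move=> z ->; rewrite !mul0r addr0 expr1n mulr1.
Qed.

(** [z - b = (z - a) * (1 + (a - b) / (z - a))], and on [K] the quotient has modulus at most 1/2, so
    the second factor can be deformed to 1. *)
Lemma nonvanishing_ext_step a b : (forall z, K z -> 2 * nrm (a - b) <= nrm (z - a)) ->
  nonvanishing_ext K phi a -> nonvanishing_ext K phi b.
Proof.
have [<-//|ab] := eqVneq a b; move=> Kab [h [ch h0 hK h1]].
(* The maximum regularizes [(z - a)^-1 = (z - a)^* / nrm (z - a) ^+ 2] near [a] without changing it
   on [K]; the floor [4 * nrm (a - b) ^+ 2] keeps [nrm (w z)] at most 1/2 everywhere. *)
pose m z := Num.max (nrm (z - a) ^+ 2) (4 * nrm (a - b) ^+ 2).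
have nab : 0 < nrm (a - b) by rewrite nrm_gt0 subr_eq0.
have m0 z : 0 < m z by rewrite lt_max; apply/orP; right; rewrite mulr_gt0 ?exprn_gt0.
pose w z := (a - b) * ((z - a)^* * ((m z)^-1)%:C).
have cza : continuous (fun z : C => z - a).
  by apply: contD; [move=> z; exact: cvg_id|exact: cont_cst].
have cw : continuous w.
  apply: contM; first exact: cont_cst.
  apply: contM; first exact: (cont_comp cza (@conj_continuous R)).
  apply: (cont_comp _ (@real_complex_continuous R)).
  apply: contV => [z|]; first by rewrite gt_eqF.
  have cn : continuous (fun z : C => nrm (z - a)) by exact: (cont_comp cza (@nrm_continuous R)).
  move=> z; apply: (@continuous_max _ _ (fun z => nrm (z - a) ^+ 2)
    (fun=> 4 * nrm (a - b) ^+ 2)); last exact: cst_continuous.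
  exact: (contM cn cn).
have nw z : nrm (w z) <= 1 / 2.
  have mV : 0 <= (m z)^-1 by rewrite invr_ge0 ltW.
  rewrite /w !nrmM nrm_conj nrm_real (ger0_norm mV) mulrA ler_pdivrMr//.
  have := nrm_ge0 (z - a); set x := nrm (z - a); set y := nrm (a - b) in nab *; move=> x0.
  rewrite /m -/x -/y maxEle; have [xy|xy] := leP (2 * y) x; case: ifPn => le_xy; nra.
have hcw z : 1 + (phi z)%:C * w z != 0.
  have /andP[p0 p1] := phi01 z.
  apply: add1_neq0; rewrite nrmM nrm_real ger0_norm//.
  apply: (@le_lt_trans _ _ (1 * (1 / 2))); last by lra.
  by rewrite ler_pM// nrm_ge0.
exists (fun z => h z * (1 + (phi z)%:C * w z)); split.
- apply: contM; first exact: ch.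
  apply: contD; first exact: cont_cst.
  by apply: contM; [exact: (cont_comp cphi (@real_complex_continuous R))|exact: cw].
- by move=> z; rewrite mulf_neq0.
- move=> z Kz; rewrite hK// phi1// mul1r.
  have hz := Kab _ Kz; have zpos : 0 < nrm (z - a) by apply: lt_le_trans hz; rewrite mulr_gt0.
  have za0 : z - a != 0 by rewrite -nrm_gt0.
  have -> : w z = (a - b) / (z - a).
    rewrite /w /m max_l; last by nra.
    congr (_ * _); apply: (mulfI za0).
    rewrite divff// mulrA mul_conj -rmorphM /= divff//.
    by rewrite expf_neq0// gt_eqF.
  by rewrite mulrDr mulr1 mulrCA divff// mulr1 subrKA.
- by move=> z pz; rewrite pz h1// mul0r addr0 mulr1.
Qed.
End Nonvanishing.

(** * Holes of a union of islands *)

Section Holes.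
Context {R : realType}.
Local Notation C := R[i].
Implicit Types (a b z w : C).

Lemma filled_bdd L : jordan_curve L -> bddC (closure (@jordan_interior R L)).
Proof.
move=> /jordan_compact/compact_bdd[M M0 LM]; exists (M + 1).
  by rewrite ltr_wpDl// ltW.
move=> z /closureCP/(_ 1 ltr01)[w Dw wz].
have := jordan_interior_bdd (ltW M0) LM Dw.
by have := nrm_sub_ge z w; rewrite nrmBC; lra.
Qed.

Lemma filled_compact L : jordan_curve L -> compact (closure (@jordan_interior R L)).
Proof. by move=> jL; apply: bdd_closed_compact; [exact: filled_bdd|exact: closed_closure]. Qed.

(* Multiplicative analogue of a logarithm of [z - a] on [K]. *)
Lemma nonvanishing_ext_filled L (phi : C -> R) (B : R) : jordan_curve L ->
  let K := closure (jordan_interior L) in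
  continuous phi -> (forall z, 0 <= phi z <= 1) -> (forall z, K z -> phi z = 1) ->
  0 < B -> (forall z, phi z != 0 -> nrm z <= B) ->
  forall a, ~ K a -> nonvanishing_ext K phi a.
Proof.
move=> jL K cphi phi01 phi1 B0 phiB.
apply: (@exterior_ind R L (nonvanishing_ext K phi) (2 * B)) => //; last first.
  by move=> a; exact: (nonvanishing_ext_far cphi phi01 phi1 B0 phiB).
move=> a Ka; have [d d0 dK] := closedCP (@closed_closure _ _) Ka.
(* The radius [d / 4] serves both directions of the equivalence: [K] is at distance at least [d]
   from [a] and still at least [3 * d / 4] from [b]. *)
exists (d / 4); first by rewrite divr_gt0.
move=> b ba; split; apply: (nonvanishing_ext_step cphi phi01 phi1) => z /dK za.
- by have := nrm_dist_tri b z a; lra.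
- by rewrite nrmBC; lra.
Qed.

(* A hole of [K] would be the set of points where [T] fails; patching [h] inside
   with [z - a0] outside would give a retraction onto a circle. *)
Lemma hole_ind (K : set C) (T : C -> Prop) (M : R) : closed K ->
  (forall a, ~ K a -> exists h : C -> C,
    [/\ continuous h, forall z, h z != 0 & forall z, K z -> h z = z - a]) ->
  (forall a, ~ K a -> exists2 e : R, 0 < e & forall b, nrm (b - a) < e -> (T b <-> T a)) ->
  (forall a, M <= nrm a -> T a) ->
  forall a, ~ K a -> T a.
Proof.
move=> cK hK Tloc Tinf a0 Ka0; apply: contrapT => Ta0.
have [h [ch h0 hKz]] := hK a0 Ka0.
pose V z := ~ K z /\ ~ T z.
pose F z := if pselect (V z) then h z else z - a0.
have cid z : (fun w : C => w - a0) w @[w --> z] --> z - a0.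
  have : continuous (fun w : C => w - a0).
    by apply: contD; [move=> x; exact: cvg_id|exact: cont_cst].
  exact.
have near_V z : ~ K z -> exists2 e : R, 0 < e & forall w, nrm (w - z) < e -> (V w <-> V z).
  move=> Kz; have [e e0 eT] := Tloc z Kz; have [d d0 dK] := closedCP cK Kz.
  exists (Num.min e d); first by rewrite lt_min e0.
  move=> w; rewrite lt_min => /andP[we wd].
  have Kw : ~ K w by move=> /dK; rewrite leNgt wd.
  by rewrite /V (propext (eT w we)); split => -[].
apply: (@no_retraction R F a0 (`|M| + nrm a0)).
- move=> z; apply: (proj2 (@cvgCP R C (nbhs z) _ F (F z))) => e e0.
  have /cvgCP/(_ e e0)/nbhsCP[d1 d10 hd1] : h x @[x --> z] --> h z by exact: ch.
  have /cvgCP/(_ e e0)/nbhsCP[d2 d20 hd2] := cid z.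
  (* At a point of [K] the two branches of [F] agree, so either one gives continuity; off [K] the
     choice of the branch is locally constant. *)
  have [Kz|Kz] := pselect (K z).
    have Fz : F z = z - a0 by rewrite /F; case: pselect => // -[].
    apply/nbhsCP; exists (Num.min d1 d2); first by rewrite lt_min d10.
    move=> w; rewrite lt_min => /andP[w1 w2] /=; rewrite Fz {1}/F.
    by case: pselect => ? /=; [rewrite -hKz//; exact: hd1|exact: hd2].
  have [d d0 dV] := near_V z Kz.
  apply/nbhsCP; exists (Num.min d (Num.min d1 d2)); first by rewrite !lt_min d0 d10.
  move=> w; rewrite !lt_min => /and3P[wd w1 w2] /=.
  rewrite /F (propext (dV w wd)); case: pselect => ? /=; [exact: hd1|exact: hd2].
- move=> z; rewrite /F; case: pselect => //= Vz; rewrite subr_eq0.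
  by apply/eqP => za0; apply: Vz; rewrite za0.
- move=> z Mz; rewrite /F; case: pselect => // Vz; exfalso; apply: (proj2 Vz); apply: Tinf.
  have := nrmB z a0; have := ler_norm M; lra.
Qed.

Context (N : nat) (L : 'I_N -> set C).
Hypothesis jL : forall i, jordan_curve (L i).
Let K i := closure (jordan_interior (L i)).
Hypothesis K0 : forall i, K i !=set0.
Hypothesis Kdisj : forall i j, i != j -> K i `&` K j = set0.

(** The factor 4 leaves room for a cutoff of range [2 * d] around one island to vanish even within
    [d] of the others. *)
Lemma filled_separation : exists2 d : R, 0 < d &
  forall i j, i != j -> forall z w, K i z -> K j w -> 4 * d <= nrm (z - w).
Proof.
have [|[i j]|d d0 h] := @common_positive_bound R ('I_N * 'I_N)%type (fun p d => p.1 != p.2 ->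
    forall z w, K p.1 z -> K p.2 w -> 4 * d <= nrm (z - w)).
- by move=> p d d' d'0 dd' h pn z w Kz Kw; apply: le_trans (h pn z w Kz Kw); lra.
- have [->|ij] := eqVneq i j; first by exists 1.
  have [|||d d0 h] := @disjoint_compact_dist R (K i) (K j).
  + exact: filled_compact.
  + exact: closed_closure.
  + exact: Kdisj.
  exists (d / 4); first by rewrite divr_gt0.
  by move=> _ z w Kz Kw; apply: le_trans (h z w Kz Kw); lra.
- by exists d => // i j; exact: (h (i, j)).
Qed.

Lemma filled_union_closed : closed (\bigcup_i K i).
Proof. by apply: closed_bigcup; [exact: finite_finset|move=> i _; exact: closed_closure]. Qed.

Lemma filled_union_bdd : bddC (\bigcup_i K i).
Proof.
have /choice[M hM] : forall i, exists M : R, 0 < M /\ forall z, K i z -> nrm z <= M.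
  by move=> i; have [M M0 h] := filled_bdd (jL i); exists M.
exists (1 + \sum_i M i).
  by rewrite ltr_pwDl// sumr_ge0// => i _; rewrite ltW// (hM i).1.
move=> z [i _ Kz]; apply: le_trans ((hM i).2 z Kz) _.
rewrite (bigD1 i)//= addrCA lerDl addr_ge0// sumr_ge0// => k _.
by rewrite ltW// (hM k).1.
Qed.

(** The product of the extensions from the single islands works: on one island the cutoffs around
    the others vanish, so all other factors are 1. *)
Lemma nonvanishing_ext_union a : ~ (\bigcup_i K i) a -> exists h : C -> C,
  [/\ continuous h, forall z, h z != 0 & forall z, (\bigcup_i K i) z -> h z = z - a].
Proof.
move=> Ka; have [d d0 dK] := filled_separation.
have /choice[h hP] : forall i, exists h, [/\ continuous h, forall z, h z != 0,
    forall z, K i z -> h z = z - a & forall z, cutoff (K i) d z = 0 -> h z = 1].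
  move=> i; have [M M0 KM] := filled_bdd (jL i).
  apply: (@nonvanishing_ext_filled (L i) (cutoff (K i) d) (M + 2 * d)).
  - exact: jL.
  - exact: cutoff_continuous.
  - by move=> z; rewrite cutoff_ge0 cutoff_le1.
  - by move=> z Kz; apply: (cutoff_eq1 d0 Kz); rewrite subrr Normc.normc0 ltW.
  - by rewrite ltr_pwDl// mulr_ge0// ltW.
  - move=> z; apply: contraNle => Mz; apply/eqP; apply: cutoff_eq0 => // w Kw.
    by have := KM w Kw; have := nrm_sub_ge z w; lra.
  - by move=> Kia; apply: Ka; exists i.
exists (fun z => \prod_i h i z); split.
- by apply: cont_prod => i; have [] := hP i.
- by move=> z; apply/prodf_neq0 => i _; have [] := hP i.
- move=> z [i _ Kz]; rewrite (bigD1 i)//= big1 ?mulr1.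
    by have [_ _ + _] := hP i; apply.
  move=> j ji; have [_ _ _] := hP j; apply.
  by apply: cutoff_eq0 => // w Kw; have := dK _ _ ji w z Kw Kz; rewrite nrmBC; lra.
Qed.

End Holes.

(** * Runge approximation *)

Section PolynomialApproximation.
Context {R : realType}.
Local Notation C := R[i].
Implicit Types (K : set C) (a b z w : C) (f g : C -> C).

Definition papprox K f := forall e : R, 0 < e ->
  exists q : {poly C}, forall z, K z -> nrm (q.[z] - f z) < e.

Lemma papprox_poly K (p : {poly C}) : papprox K (horner p).
Proof. by move=> e e0; exists p => z _; rewrite subrr Normc.normc0. Qed.

Lemma papprox_cst K (c : C) : papprox K (fun=> c).
Proof. by move=> e e0; exists c%:P => z _; rewrite hornerC subrr Normc.normc0. Qed.

Lemma papprox_lim K f : (forall e : R, 0 < e ->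
    exists2 g, papprox K g & forall z, K z -> nrm (g z - f z) < e) -> papprox K f.
Proof.
move=> h e e0; have e20 : 0 < e / 2 by rewrite divr_gt0.
have [g /(_ _ e20)[q qg] gf] := h _ e20.
exists q => z Kz; apply: le_lt_trans (nrm_dist_tri (g z) _ _) _.
by rewrite [e]splitr ltrD ?qg ?gf.
Qed.

Lemma papprox_ext K f g : (forall z, K z -> f z = g z) -> papprox K f -> papprox K g.
Proof. by move=> fg h e /h[q qf]; exists q => z Kz; rewrite -fg ?qf. Qed.

Lemma papproxD K f g : papprox K f -> papprox K g -> papprox K (fun z => f z + g z).
Proof.
move=> hf hg e e0; have e20 : 0 < e / 2 by rewrite divr_gt0.
have [p pf] := hf _ e20; have [q qg] := hg _ e20.
exists (p + q) => z Kz; rewrite hornerD opprD addrACA.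
by apply: le_lt_trans (nrmD _ _) _; rewrite [e]splitr ltrD ?pf ?qg.
Qed.

Definition bounded_on K f := exists2 M : R, 0 < M & forall z, K z -> nrm (f z) <= M.

Lemma papproxM K f g : bounded_on K f -> bounded_on K g ->
  papprox K f -> papprox K g -> papprox K (fun z => f z * g z).
Proof.
move=> [M M0 fM] [M' M'0 gM] hf hg e e0.
pose d := e / (2 * (M + M' + 1)).
have MM : 0 < M + M' + 1 by rewrite !addr_gt0.
have d0 : 0 < d by rewrite divr_gt0// mulr_gt0.
have d10 : 0 < Num.min d 1 by rewrite lt_min d0 ltr01.
have [p pf] := hf _ d0; have [q qg] := hg _ d10.
exists (p * q) => z Kz; rewrite hornerM.
have -> : p.[z] * q.[z] - f z * g z = (p.[z] - f z) * (q.[z] - g z + g z) + f z * (q.[z] - g z).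
  by ring.
have h1 := pf _ Kz; have := qg _ Kz; rewrite lt_min => /andP[h2 h3].
have h4 := fM _ Kz; have h5 := gM _ Kz.
apply: le_lt_trans (nrmD _ _) _; rewrite !nrmM.
apply: (@le_lt_trans _ _ (d * (1 + M') + M * d)).
  apply: lerD; apply: ler_pM; rewrite ?nrm_ge0 ?(ltW h1) ?(ltW h2)//.
  by apply: le_trans (nrmD _ _) _; rewrite lerD// ltW.
rewrite (_ : _ + _ = d * (M + M' + 1)); last by ring.
by rewrite /d invfM mulrA mulfVK ?gt_eqF// ltr_pdivrMr// ltr_pMr// ltr1n.
Qed.

Lemma bounded_onX K f n : bounded_on K f -> bounded_on K (fun z => f z ^+ n).
Proof.
move=> [M M0 fM]; exists (M ^+ n); rewrite ?exprn_gt0// => z Kz.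
by rewrite nrmX lerXn2r ?nnegrE ?nrm_ge0 ?fM// ltW.
Qed.

Lemma papproxX K f n : bounded_on K f -> papprox K f -> papprox K (fun z => f z ^+ n).
Proof.
move=> bf hf; elim: n => [|n IHn]; first exact: papprox_cst.
apply: (@papprox_ext _ (fun z => f z * f z ^+ n)) => [z _|]; first by rewrite exprS.
by apply: papproxM => //; exact: bounded_onX.
Qed.

Lemma papprox_sum K (I : Type) (s : seq I) (F : I -> C -> C) :
  (forall i, papprox K (F i)) -> papprox K (fun z => \sum_(i <- s) F i z).
Proof.
move=> hF; elim: s => [|i s IHs].
  by apply: (papprox_ext _ (@papprox_cst K 0)) => z _; rewrite big_nil.
by apply: (papprox_ext _ (papproxD (hF i) IHs)) => z _; rewrite big_cons.
Qed.

Lemma papproxZ K c f : papprox K f -> papprox K (fun z => c * f z).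
Proof.
move=> hf e e0; have [->|c0] := eqVneq c 0.
  by exists 0 => z _; rewrite horner0 mul0r subrr Normc.normc0.
have nc0 : 0 < nrm c by rewrite nrm_gt0.
have [|q qf] := hf (e / nrm c); first by rewrite divr_gt0.
exists (c *: q) => z Kz; rewrite hornerZ -mulrBr nrmM mulrC -ltr_pdivlMr//.
exact: qf.
Qed.

Lemma pow_half_lt (e : R) : 0 < e -> exists n : nat, 2 * (1 / 2) ^+ n < e.
Proof.
move=> e0; pose n := (Num.truncn (2 / e)).+1; exists n.
have h : 2 / e < n%:R by exact: truncnS_gt.
have h2 : n%:R <= 2 ^+ n :> R by rewrite -natrX ler_nat ltnW// ltn_expl.
rewrite expr_div_n expr1n mulrA mulr1 ltr_pdivrMr ?exprn_gt0// mulrC.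
by rewrite -ltr_pdivrMr// (lt_le_trans h).
Qed.

Lemma half_sub1_ge w : nrm w <= 1 / 2 -> 1 / 2 <= nrm (1 - w).
Proof. by move=> h; have := nrm_sub_ge 1 w; rewrite Normc.normc1; lra. Qed.

Lemma papprox_geometric K f : papprox K f -> (forall z, K z -> nrm (f z) <= 1 / 2) ->
  papprox K (fun z => (1 - f z)^-1).
Proof.
move=> hf f2; apply: papprox_lim => e e0.
have [n ne] := pow_half_lt e0.
exists (fun z => \sum_(k < n) f z ^+ k).
  apply: papprox_sum => k; apply: papproxX => //.
  by exists (1 / 2) => //; rewrite divr_gt0.
move=> z Kz; have := half_sub1_ge (f2 z Kz) => h1.
have h2 : 0 < nrm (1 - f z) by apply: lt_le_trans h1; rewrite divr_gt0.
have fz1 : 1 - f z != 0 by rewrite -nrm_gt0.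
have -> : \sum_(k < n) f z ^+ k - (1 - f z)^-1 = - f z ^+ n / (1 - f z).
  apply: (mulfI fz1); rewrite mulrBr divff// mulrCA divff// mulr1.
  have := subrX1 (f z) n; set S := \sum_(k < n) _ => S1.
  have -> : (1 - f z) * S = - ((f z - 1) * S) by ring.
  rewrite -S1. ring.
rewrite nrmM nrmN nrmV nrmX ltr_pdivrMr//; apply: le_lt_trans (_ : (1 / 2) ^+ n < _).
  by rewrite lerXn2r ?nnegrE ?nrm_ge0 ?f2.
by apply: (@lt_le_trans _ _ (e * (1 / 2))); [lra|rewrite ler_pM2l].
Qed.

Lemma papprox_pole_far K (B : R) a : 0 < B -> (forall z, K z -> nrm z <= B) -> 2 * B <= nrm a ->
  papprox K (fun z => (z - a)^-1).
Proof.
move=> B0 KB aB; have na0 : 0 < nrm a by apply: lt_le_trans aB; rewrite mulr_gt0.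
have a0 : a != 0 by rewrite -nrm_gt0.
apply: (@papprox_ext _ (fun z => - a^-1 * (1 - z * a^-1)^-1)).
  move=> z Kz; rewrite -invrN -invfM; congr (_^-1); field; exact: a0.
apply: papproxZ; apply: papprox_geometric.
  apply: (papprox_ext _ (papproxZ a^-1 (papprox_poly K 'X))) => z _.
  by rewrite hornerX mulrC.
by move=> z /KB zB; rewrite nrmM nrmV ler_pdivrMr//; lra.
Qed.

(** Pole pushing: [(z - b)^-1] is [(z - a)^-1] times a geometric series in [(b - a) / (z - a)],
    whose modulus on [K] is at most 1/2. *)
Lemma papprox_pole_step K (d : R) a b : 0 < d -> (forall z, K z -> d <= nrm (z - a)) ->
  (forall z, K z -> 2 * nrm (b - a) <= nrm (z - a)) ->
  papprox K (fun z => (z - a)^-1) -> papprox K (fun z => (z - b)^-1).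
Proof.
move=> d0 Kd Kab ha.
have w2 z : K z -> nrm ((b - a) * (z - a)^-1) <= 1 / 2.
  move=> Kz; have zd : 0 < nrm (z - a) := lt_le_trans d0 (Kd z Kz).
  by rewrite nrmM nrmV ler_pdivrMr//; have := Kab z Kz; lra.
apply: (@papprox_ext _ (fun z => (z - a)^-1 * (1 - (b - a) * (z - a)^-1)^-1)).
  move=> z Kz; have zd : 0 < nrm (z - a) := lt_le_trans d0 (Kd z Kz).
  have za : z - a != 0 by rewrite -nrm_gt0.
  by rewrite -invfM; congr (_^-1); field.
apply: papproxM => //.
- exists d^-1; rewrite ?invr_gt0// => z Kz; rewrite nrmV lef_pV2 ?posrE ?Kd//.
  exact: lt_le_trans d0 (Kd z Kz).
- exists 2 => // z Kz; rewrite nrmV -[leRHS]invrK lef_pV2 ?posrE ?invr_gt0//.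
    by have := half_sub1_ge (w2 z Kz); rewrite div1r.
  by apply: lt_le_trans (half_sub1_ge (w2 z Kz)); rewrite divr_gt0.
- by apply: papprox_geometric => //; exact: papproxZ.
Qed.

(** By pole pushing, approximability of [(z - a)^-1] is locally constant in [a] off [K]; it holds
    for far [a], and [hole_ind] does the rest. *)
Lemma papprox_pole (K : set C) (B : R) : closed K -> 0 < B -> (forall z, K z -> nrm z <= B) ->
  (forall a, ~ K a -> exists h : C -> C,
    [/\ continuous h, forall z, h z != 0 & forall z, K z -> h z = z - a]) ->
  forall a, ~ K a -> papprox K (fun z => (z - a)^-1).
Proof.
move=> cK B0 KB hK.
apply: (@hole_ind R K (fun a => papprox K (fun z => (z - a)^-1)) (2 * B) cK hK).
  move=> a Ka; have [d d0 dK] := closedCP cK Ka.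
  exists (d / 4); first by rewrite divr_gt0.
  move=> b ba; have d40 : 0 < d / 4 by rewrite divr_gt0.
  have db z : K z -> d / 2 <= nrm (z - b).
    by move/dK => za; have := nrm_dist_tri b z a; lra.
  split.
  - apply: (papprox_pole_step d40) => z Kz; last by rewrite nrmBC; have := db z Kz; lra.
    by have := db z Kz; lra.
  - by apply: (papprox_pole_step d0) => // z Kz; have := dK z Kz; lra.
by move=> a; exact: papprox_pole_far.
Qed.

End PolynomialApproximation.

(** * Cauchy's formula on a square, in closed form *)

Section EdgeIntegrals.
Context {R : realType}.
Local Notation C := R[i].
Implicit Types (u v t h : R).

Lemma atanDinv_gt0 t : 0 < t -> atan t + atan t^-1 = pi / 2.
Proof.
move=> t0; have ta := atanK t.
have a1 := atan_ltpi2 t.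
have a0 : 0 < atan t by rewrite -(@atan0 R); exact: lt_atan.
suff -> : t^-1 = tan (pi / 2 - atan t) by rewrite tanK ?subrKC// in_itv /=; apply/andP; split; lra.
by rewrite -[in LHS]ta /tan sinB cosB sin_pihalf cos_pihalf mul1r !mul0r subr0 add0r mul1r invf_div.
Qed.

(* Valid also when [u] or [v] is [0], thanks to [x / 0 = 0] and [sg 0 = 0]. *)
Lemma atan_div_inv u v : atan (u / v) + atan (v / u) = pi / 2 * (Num.sg u * Num.sg v).
Proof.
have [->|u0] := eqVneq u 0; first by rewrite sgr0 !mul0r invr0 !mulr0 !atan0 addr0.
have [->|v0] := eqVneq v 0; first by rewrite sgr0 !mul0r invr0 !mulr0 !atan0 addr0.
have -> : v / u = (u / v)^-1 by rewrite invf_div.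
rewrite -(sgrV v) -sgrM; have : u / v != 0 by rewrite mulf_neq0 ?invr_eq0.
move: (u / v) => t t0; have [t0'|t0'|t0'] := ltgtP t 0; last by rewrite t0' eqxx in t0.
  have := @atanDinv_gt0 (- t); rewrite oppr_gt0 invrN !atanN ltr0_sg// => /(_ t0'); lra.
by rewrite gtr0_sg// mulr1 atanDinv_gt0.
Qed.

(** The real part of log (u + iv), for (u, v) other than the origin. *)
Definition lgmod u v := ln (u ^+ 2 + v ^+ 2) / 2.

(* The integrals of [1 / zeta] along the horizontal edge from [u0 + iv] to
   [u1 + iv] and along the vertical edge from [u + iv0] to [u + iv1]. *)
Definition edge_h u0 u1 v : C :=
  (lgmod u1 v - lgmod u0 v) -i* (atan (u1 / v) - atan (u0 / v)).

Definition edge_v u v0 v1 : C :=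
  (lgmod u v1 - lgmod u v0) +i* (atan (v1 / u) - atan (v0 / u)).

(** The logarithms cancel and the arctangents pair up at the corners by [atan_div_inv]. For
    [u0 < u1] and [v0 < v1] the product of the sign jumps is 4 if the origin is strictly inside,
    which gives 2 pi i, and 0 if it is outside; on the boundary it takes intermediate values that
    still add up correctly over adjacent squares. *)
Lemma square_edges u0 u1 v0 v1 :
  edge_h u0 u1 v0 + edge_v u1 v0 v1 - edge_h u0 u1 v1 - edge_v u0 v0 v1 =
  0 +i* (pi / 2 * ((Num.sg u1 - Num.sg u0) * (Num.sg v1 - Num.sg v0))).
Proof.
apply/eqP; rewrite eq_complex /=; apply/andP; split; apply/eqP; first by ring.
transitivity ((atan (u1 / v1) + atan (v1 / u1)) - (atan (u1 / v0) + atan (v0 / u1))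
  - (atan (u0 / v1) + atan (v1 / u0)) + (atan (u0 / v0) + atan (v0 / u0))); first by ring.
by rewrite !atan_div_inv; ring.
Qed.

Lemma is_derive_lgmod t v : 0 < t ^+ 2 + v ^+ 2 ->
  is_derive t 1 (fun t => lgmod t v) (t / (t ^+ 2 + v ^+ 2)).
Proof.
move=> tv.
have h1 : is_derive t 1 (fun t : R => t ^+ 2 + v ^+ 2) (2 * t).
  by apply: is_derive_eq; rewrite addr0 /GRing.scale /=; ring.
have h2 : is_derive t 1 (fun t : R => ln (t ^+ 2 + v ^+ 2)) ((t ^+ 2 + v ^+ 2)^-1 * (2 * t)).
  by apply: is_derive1_comp; exact: is_derive1_ln.
have h3 : is_derive t 1 (fun t : R => lgmod t v) (2^-1 * ((t ^+ 2 + v ^+ 2)^-1 * (2 * t))).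
  have -> : (fun t : R => lgmod t v) = 2^-1 *: (fun t : R => ln (t ^+ 2 + v ^+ 2)).
    by apply/funext => x; rewrite /lgmod mulrC.
  exact: is_deriveZ.
apply: is_derive_eq; field.
by rewrite gt_eqF.
Qed.

Lemma is_derive_atan_div t v : 0 < t ^+ 2 + v ^+ 2 ->
  is_derive t 1 (fun t => atan (t / v)) (v / (t ^+ 2 + v ^+ 2)).
Proof.
move=> tv; have [->|v0] := eqVneq v 0.
  have -> : (fun t : R => atan (t / 0)) = cst (atan 0).
    by apply/funext => x; rewrite invr0 mulr0.
  by rewrite mul0r; exact: is_derive_cst.
have h1 : is_derive t 1 (fun t : R => t / v) v^-1.
  have -> : (fun t : R => t / v) = v^-1 *: id by apply/funext => x; rewrite mulrC.
  by apply: is_derive_eq; rewrite /GRing.scale /= mulr1.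
have h2 : is_derive t 1 (fun t : R => atan (t / v)) ((1 + (t / v) ^+ 2)^-1 * v^-1).
  by apply: is_derive1_comp.
have tv0 : t ^+ 2 + v ^+ 2 != 0 by rewrite gt_eqF.
apply: is_derive_eq; field.
by rewrite v0 tv0.
Qed.

Lemma invB (F : fieldType) (x y : F) : x != 0 -> y != 0 ->
  x^-1 - y^-1 = (y - x) * (x^-1 * y^-1).
Proof. by move=> x0 y0; field; rewrite x0 y0. Qed.

(** By the mean value theorem the real and the imaginary part are [h] times the corresponding part
    of 1/zeta at points of the edge, where 1/zeta differs from its value at the left end by at most
    [2 * h / rho ^+ 2]. *)
Lemma edge_h_estimate u v h (rho : R) : 0 < h -> 0 < rho -> h <= rho / 4 ->
  rho <= nrm (u +i* v) ->
  nrm (edge_h u (u + h) v - h%:C / (u +i* v)) <= 4 * h ^+ 2 / rho ^+ 2.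
Proof.
move=> h0 rho0 hrho uv.
have far t : u <= t <= u + h -> rho / 2 <= nrm (t +i* v).
  move=> /andP[t1 t2]; have := nrm_sub_ge (u +i* v) (t +i* v).
  have -> : u +i* v - t +i* v = (u - t)%:C.
    by apply/eqP; rewrite eq_complex /= subrr !eqxx.
  by rewrite nrm_real ler0_norm; lra.
have den t : u <= t <= u + h -> 0 < t ^+ 2 + v ^+ 2.
  move=> /far tv; have := sqr_nrm (t +i* v) => /= <-.
  by rewrite exprn_gt0// (lt_le_trans _ tv)// divr_gt0.
have uuh : u < u + h by rewrite ltrDl.
have close t : u <= t <= u + h ->
    nrm ((t +i* v)^-1 - (u +i* v)^-1) <= 2 * h / rho ^+ 2.
  move=> tt; have tv := far _ tt; move: tt => /andP[t1 t2].
  have t0 : t +i* v != 0 by rewrite -nrm_gt0 (lt_le_trans _ tv)// divr_gt0.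
  have u0 : u +i* v != 0 by rewrite -nrm_gt0 (lt_le_trans _ uv).
  have -> : (t +i* v)^-1 - (u +i* v)^-1 = (u +i* v - t +i* v) * ((t +i* v)^-1 * (u +i* v)^-1).
    exact: invB.
  have -> : u +i* v - t +i* v = (u - t)%:C.
    by apply/eqP; rewrite eq_complex /= subrr !eqxx.
  rewrite !nrmM !nrmV nrm_real ler0_norm; last by lra.
  have -> : 2 * h / rho ^+ 2 = h * ((rho / 2)^-1 * rho^-1) by field; rewrite gt_eqF.
  apply: ler_pM; rewrite ?mulr_ge0 ?invr_ge0 ?nrm_ge0//; [lra|lra|].
  apply: ler_pM; rewrite ?invr_ge0 ?nrm_ge0// lef_pV2 ?posrE ?divr_gt0//.
    by apply: lt_le_trans tv; rewrite divr_gt0.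
  exact: lt_le_trans uv.
have sub_itv t : t \in `]u, (u + h)[ -> u <= t <= u + h.
  by rewrite in_itv /= => /andP[/ltW-> /ltW->].
have [|t1 t1I E1] := @MVT R (fun t => lgmod t v) (fun t => t / (t ^+ 2 + v ^+ 2)) u (u + h) uuh
  (fun t tI => is_derive_lgmod (den t (sub_itv t tI))).
  apply: derivable_within_continuous => t tI.
  by have [] := is_derive_lgmod (den t tI).
have [|t2 t2I E2] := @MVT R (fun t => atan (t / v)) (fun t => v / (t ^+ 2 + v ^+ 2)) u (u + h) uuh
  (fun t tI => is_derive_atan_div (den t (sub_itv t tI))).
  apply: derivable_within_continuous => t tI.
  by have [] := is_derive_atan_div (den t tI).
have hC (w : C) : cRe (h%:C * w) = h * cRe w /\ cIm (h%:C * w) = h * cIm w.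
  by case: w => a b /=; rewrite !mul0r subr0 addr0.
apply: le_trans (nrm_le_ReIm _) _; rewrite !(ReD, ImD, ReN, ImN) !(hC _).1 !(hC _).2.
rewrite /edge_h [cRe (_ -i* _)]/= [cIm (_ -i* _)]/= E1 E2.
have -> : 4 * h ^+ 2 / rho ^+ 2 = h * (2 * h / rho ^+ 2) + h * (2 * h / rho ^+ 2) by field; rewrite gt_eqF.
have addrKh : u + h - u = h by rewrite addrC addKr.
rewrite addrKh; apply: lerD.
  rewrite [_ * h]mulrC -mulrBr normrM gtr0_norm// ler_pM2l//.
  apply: le_trans (close _ (sub_itv _ t1I)); apply: le_trans (Re_le_nrm _).
  by rewrite ReD ReN.
rewrite [_ * h]mulrC -mulrN -mulrBr normrM gtr0_norm// ler_pM2l//.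
apply: le_trans (close _ (sub_itv _ t2I)); apply: le_trans (Im_le_nrm _).
by rewrite ImD ImN.
Qed.

(** The conjugate of a vertical edge integral is a horizontal one with the coordinates exchanged. *)
Lemma edge_v_estimate u v h (rho : R) : 0 < h -> 0 < rho -> h <= rho / 4 ->
  rho <= nrm (u +i* v) ->
  nrm (edge_v u v (v + h) - 'i * h%:C / (u +i* v)) <= 4 * h ^+ 2 / rho ^+ 2.
Proof.
move=> h0 rho0 hrho uv; rewrite -nrm_conj.
have -> : (edge_v u v (v + h) - 'i * h%:C / (u +i* v))^* =
    edge_h v (v + h) u - h%:C / (v +i* u).
  rewrite /edge_v /edge_h rmorphB /= /lgmod ![u ^+ 2 + _]addrC.
  congr (_ - _); apply/eqP; rewrite eq_complex /=.
  by apply/andP; split; apply/eqP; ring.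
apply: edge_h_estimate => //.
by move: uv; rewrite /Normc.normc addrC.
Qed.

End EdgeIntegrals.

Lemma summation_by_parts1 (V : comPzRingType) (s B : nat -> V) n : s 0%N = 0 -> s n = 0 ->
  \sum_(j < n) s j * (B j - B j.+1) = \sum_(j < n) (s j.+1 - s j) * B j.+1.
Proof.
move=> s0 sn; apply/eqP; rewrite -subr_eq0 -sumrB.
rewrite (eq_bigr (fun j : 'I_n => - (s j.+1 * B j.+1 - s j * B j))); last by move=> j _; ring.
by rewrite sumrN -(big_mkord xpredT (fun j => s j.+1 * B j.+1 - s j * B j))
  telescope_sumr// sn s0 !mul0r subrr oppr0.
Qed.

(** A discrete Green formula: with [B] and [W] for the bottom and left sides, a weighted sum of
    integrals around squares becomes a sum over edges, each weighted by the jump of [s] across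
    it. *)
Lemma summation_by_parts2 (V : comPzRingType) (s B W : nat -> nat -> V) n :
  (forall i, s i 0%N = 0) -> (forall i, s i n = 0) ->
  (forall j, s 0%N j = 0) -> (forall j, s n j = 0) ->
  \sum_(i < n) \sum_(j < n) s i j * (B i j + W i.+1 j - B i j.+1 - W i j) =
  \sum_(i < n) \sum_(j < n) ((s i j.+1 - s i j) * B i j.+1 - (s i.+1 j - s i j) * W i.+1 j).
Proof.
move=> si0 sin s0j snj.
transitivity (\sum_(i < n) \sum_(j < n) s i j * (B i j - B i j.+1) -
              \sum_(i < n) \sum_(j < n) s i j * (W i j - W i.+1 j)).
  rewrite -sumrB; apply: eq_bigr => i _; rewrite -sumrB; apply: eq_bigr => j _; ring.
rewrite [X in _ - X]exchange_big /=.
rewrite (eq_bigr (fun i : 'I_n => \sum_(j < n) (s i j.+1 - s i j) * B i j.+1)); last first.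
  by move=> i _; exact: summation_by_parts1.
rewrite [X in _ - X](eq_bigr (fun j : 'I_n => \sum_(i < n) (s i.+1 j - s i j) * W i.+1 j)); last first.
  by move=> j _; exact: (@summation_by_parts1 _ (s^~ j) (W^~ j)).
rewrite [X in _ - X]exchange_big /= -sumrB; apply: eq_bigr => i _.
by rewrite -sumrB.
Qed.

(** * Approximating an indicator by Riemann sums of Cauchy integrals *)

Section Indicator.
Context {R : realType}.
Local Notation C := R[i].
Context (A A' : set C) (B d : R) (chi : C -> R).
Hypotheses (A0 : A !=set0) (d0 : 0 < d) (B0 : 0 < B)
  (AB : forall z, (A `|` A') z -> nrm z <= B)
  (Ad : forall z w, A z -> A' w -> 4 * d <= nrm (z - w))
  (chi1 : forall z, A z -> chi z = 1) (chi0 : forall z, A' z -> chi z = 0).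
Let K := A `|` A'.

(** The weight is thus constant near each point of [K], so the edges across which it jumps, and with
    them the poles of the grid sum, stay away from [K]. *)
Lemma cutoff_chi (p z : C) : K z -> nrm (p - z) <= d -> cutoff A d p = chi z.
Proof.
move=> [Az|A'z] pz; first by rewrite chi1// (cutoff_eq1 d0 Az).
rewrite chi0//; apply: cutoff_eq0 => // w Aw; have := Ad Aw A'z.
by have := nrm_dist_tri p w z; rewrite (nrmBC w p); have := d0; lra.
Qed.

Let W := B + 2 * d.
Let W0 : 0 < W. Proof. by rewrite addr_gt0// mulr_gt0. Qed.

Section Grid.
Variable n : nat.
Hypothesis n0 : (0 < n)%N.
Let h := 2 * W / n%:R.
Hypothesis hd : h <= d / 8.
Let x (i : nat) : R := - W + i%:R * h.
Let p i j : C := x i +i* x j.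
Let s i j : R := cutoff A d (p i j).

Let h0 : 0 < h. Proof. by rewrite divr_gt0 ?ltr0n// mulr_gt0. Qed.
Let nh : n%:R * h = 2 * W.
Proof. by rewrite mulrC divfK// pnatr_eq0 -lt0n. Qed.
Let xS i : x i.+1 = x i + h.
Proof. by rewrite /x -addrA -[i.+1]addn1 natrD mulrDl mul1r. Qed.
Let x0E : x 0%N = - W. Proof. by rewrite /x mul0r addr0. Qed.
Let xnE : x n = W. Proof. by rewrite /x nh; ring. Qed.

Let s_border i j : W <= `|x i| \/ W <= `|x j| -> s i j = 0.
Proof.
move=> hW; apply: cutoff_eq0 => // w Aw; have wB : nrm w <= B by apply: AB; left.
have pW : B + 2 * d <= nrm (p i j).
  case: hW => /le_trans; apply; [exact: (Re_le_nrm (p i j))|exact: (Im_le_nrm (p i j))].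
by have := nrm_sub_ge (p i j) w; lra.
Qed.

(** Riemann sum, sampled at the left or lower end of each edge, for the Cauchy integral over the
    edges weighted by the jumps of the cutoff. It is rational in [z], with poles at grid points. *)
Definition grid_sum (z : C) : C := \sum_(i < n) \sum_(j < n)
  ((s i j.+1 - s i j)%:C * (h%:C / (p i j.+1 - z)) -
   (s i.+1 j - s i j)%:C * ('i * h%:C / (p i.+1 j - z))).

Let far_edge a b i j z : K z -> nrm (p a b - p i j) <= h -> s a b != s i j ->
  d / 2 <= nrm (p a b - z).
Proof.
move=> Kz pp; apply: contraNle => pz; apply/eqP; rewrite /s.
rewrite (@cutoff_chi (p a b) z)//; last by have := d0; lra.
rewrite (@cutoff_chi (p i j) z)//.
by have := nrm_dist_tri (p a b) (p i j) z; rewrite (nrmBC (p i j) (p a b)); have := d0; have := hd; lra.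
Qed.

Let pphor i j : p i j.+1 - p i j = 'i * h%:C.
Proof.
by rewrite /p xS; apply/eqP; rewrite eq_complex /=; apply/andP; split; apply/eqP; ring.
Qed.
Let ppver i j : p i.+1 j - p i j = h%:C.
Proof.
by rewrite /p xS; apply/eqP; rewrite eq_complex /=; apply/andP; split; apply/eqP; ring.
Qed.
Let pphor_nrm i j : nrm (p i j.+1 - p i j) <= h.
Proof. by rewrite pphor nrmM nrm_i mul1r nrm_real gtr0_norm. Qed.
Let ppver_nrm i j : nrm (p i.+1 j - p i j) <= h.
Proof. by rewrite ppver nrm_real gtr0_norm. Qed.

Lemma papprox_grid_sum : (forall a, ~ K a -> papprox K (fun z => (z - a)^-1)) ->
  papprox K grid_sum.
Proof.
move=> poles.
have term (c : R) (e : C) q : (c != 0 -> ~ K q) -> papprox K (fun z => c%:C * (e / (q - z))).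
  move=> cq; have [->|/cq Kq] := eqVneq c 0.
    by apply: (papprox_ext _ (@papprox_cst R K 0)) => z _; rewrite mul0r.
  apply: papproxZ; apply: (papprox_ext _ (papproxZ (- e) (poles q Kq))) => z _.
  by rewrite mulNr -mulrN -invrN opprB.
have notK a b i j : nrm (p a b - p i j) <= h -> s a b - s i j != 0 -> ~ K (p a b).
  rewrite subr_eq0 => pp ss Kp; have := far_edge Kp pp ss.
  by rewrite subrr Normc.normc0; have := d0; lra.
apply: papprox_sum => i; apply: papprox_sum => j; apply: papproxD.
  by apply: term; exact: notK.
apply: (papprox_ext _ (papproxZ (-1) (@term (s i.+1 j - s i j) ('i * h%:C) (p i.+1 j) _))) => [z _|].
  by rewrite mulN1r.
by apply: notK.
Qed.

Let edge_error a b i j z (e E : C) : K z -> nrm (p a b - p i j) <= h ->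
  (d / 2 <= nrm (p a b - z) -> nrm (E - e) <= 4 * h ^+ 2 / (d / 2) ^+ 2) ->
  nrm ((s a b - s i j)%:C * E - (s a b - s i j)%:C * e) <= 16 * h ^+ 3 / d ^+ 3.
Proof.
move=> Kz pp hE; rewrite -mulrBr nrmM nrm_real.
have [->|ss] := eqVneq (s a b) (s i j).
  by rewrite subrr normr0 mul0r divr_ge0 ?mulr_ge0 ?exprn_ge0// ltW.
have -> : 16 * h ^+ 3 / d ^+ 3 = h / d * (4 * h ^+ 2 / (d / 2) ^+ 2) by field; rewrite gt_eqF.
apply: ler_pM; rewrite ?nrm_ge0//; last by apply: hE; exact: (far_edge Kz pp ss).
apply: le_trans (cutoff_lipschitz _ _ d0 A0) _.
by rewrite ler_pM2r ?invr_gt0.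
Qed.

Let u z i := x i - cRe z.
Let v z j := x j - cIm z.
Let pz z i j : p i j - z = u z i +i* v z j. Proof. by case: z. Qed.

Definition grid_edges (z : C) : C := \sum_(i < n) \sum_(j < n)
  ((s i j.+1 - s i j)%:C * edge_h (u z i) (u z i.+1) (v z j.+1) -
   (s i.+1 j - s i j)%:C * edge_v (u z i.+1) (v z j) (v z j.+1)).

(** Undoing the summation by parts leaves squares weighted by [s]. Only squares touching [z]
    contribute; their corners are within [2 * h] of [z], where the weight is [chi z], and the sign
    jumps telescope to [2] in each direction. *)
Lemma grid_edgesE z : K z -> grid_edges z = 'i * (2 * pi * chi z)%:C.
Proof.
move=> Kz.
pose sC i j : C := (s i j)%:C.
rewrite /grid_edges.
transitivity (\sum_(i < n) \sum_(j < n) ((sC i j.+1 - sC i j) * edge_h (u z i) (u z i.+1) (v z j.+1) -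
   (sC i.+1 j - sC i j) * edge_v (u z i.+1) (v z j) (v z j.+1))).
  by apply: eq_bigr => i _; apply: eq_bigr => j _; rewrite !rmorphB.
rewrite -(@summation_by_parts2 _ sC (fun i j => edge_h (u z i) (u z i.+1) (v z j))
  (fun i j => edge_v (u z i) (v z j) (v z j.+1))); first last.
- by move=> j; rewrite /sC s_border// xnE; left; exact: ler_norm.
- by move=> j; rewrite /sC s_border// x0E normrN; left; exact: ler_norm.
- by move=> i; rewrite /sC s_border// xnE; right; exact: ler_norm.
- by move=> i; rewrite /sC s_border// x0E normrN; right; exact: ler_norm.
have zB : nrm z <= B by exact: AB.
have sgn0 (a : C -> R) : `|a z| <= nrm z -> Num.sg (x n - a z) - Num.sg (x 0%N - a z) = 2.
  move=> az; rewrite xnE x0E gtr0_sg ?ltr0_sg; first by rewrite opprK.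
    by have := ler_norm (- a z); rewrite normrN /W; have := d0; lra.
  by have := ler_norm (a z); rewrite /W; have := d0; lra.
transitivity (\sum_(i < n) \sum_(j < n) 'i * (chi z * (pi / 2) * ((Num.sg (u z i.+1) - Num.sg (u z i)) *
   (Num.sg (v z j.+1) - Num.sg (v z j))))%:C).
  apply: eq_bigr => i _; apply: eq_bigr => j _; rewrite square_edges /sC.
  set q := _ * (Num.sg _ - _).
  have -> : (0 +i* (pi / 2 * q) : C) = 'i * (pi / 2 * q)%:C.
    by apply/eqP; rewrite eq_complex /=; apply/andP; split; apply/eqP; ring.
  rewrite mulrCA -rmorphM /=; congr (_ * _%:C).
  have [->|q0] := eqVneq q 0; first by rewrite !mulr0.
  suff pij : nrm (p i j - z) <= d by rewrite /s (cutoff_chi Kz pij); ring.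
  have sgn_step (a : R) : Num.sg (a + h) - Num.sg a != 0 -> `|a| <= h.
    have := h0; case: (ltrgtP a 0) => [a0|a0|->] hpos.
    - have [ah|ah] := leP 0 (a + h); first by rewrite ltr0_norm// => _; lra.
      by rewrite (ltr0_sg ah) (ltr0_sg a0) subrr eqxx.
    - by rewrite !gtr0_sg ?addr_gt0// subrr eqxx.
    - by rewrite normr0 => _; exact: ltW.
  move: q0; rewrite mulf_eq0 negb_or => /andP[q1 q2].
  apply: le_trans (nrm_le_ReIm _) _; rewrite pz /=.
  have := sgn_step (u z i); have := sgn_step (v z j).
  rewrite /u /v -![x _ - _ + h]addrAC -!xS => /(_ q2) h2 /(_ q1) h1; have := hd; have := d0; lra.
rewrite (eq_bigr (fun i : 'I_n => 'i * (chi z * pi * (Num.sg (u z i.+1) - Num.sg (u z i)))%:C)); last first.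
  move=> i _; rewrite -mulr_sumr -rmorph_sum /= -!mulr_sumr; congr (_ * _%:C).
  rewrite -(big_mkord xpredT (fun j => Num.sg (v z j.+1) - Num.sg (v z j))) telescope_sumr// sgn0 ?Im_le_nrm//.
  by field.
rewrite -mulr_sumr -rmorph_sum /= -!mulr_sumr; congr (_ * _%:C).
rewrite -(big_mkord xpredT (fun j => Num.sg (u z j.+1) - Num.sg (u z j))) telescope_sumr// sgn0 ?Re_le_nrm//.
by ring.
Qed.

(** With [2 * n ^ 2] edges and [n * h] fixed, a quadrature error of order [h ^+ 2] per edge would
    only sum to a constant. The Lipschitz jump contributes one more factor [h / d], which makes the
    total of order [h]. *)
Lemma grid_sum_estimate z : K z ->
  nrm (grid_sum z - 'i * (2 * pi * chi z)%:C) <= 128 * W ^+ 2 * h / d ^+ 3.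
Proof.
move=> Kz; rewrite -grid_edgesE// nrmBC /grid_edges /grid_sum -sumrB.
have -> : 128 * W ^+ 2 * h / d ^+ 3 = \sum_(i < n) \sum_(j < n) (2 * (16 * h ^+ 3 / d ^+ 3)).
  rewrite !sumr_const !card_ord -mulrnA -[RHS]mulr_natl natrM.
  transitivity (32 * (n%:R * h) ^+ 2 * h / d ^+ 3); last by ring.
  by rewrite nh; ring.
apply: le_trans (nrm_sum _ _ _) _; apply: ler_sum => i _; rewrite -sumrB.
apply: le_trans (nrm_sum _ _ _) _; apply: ler_sum => j _.
rewrite opprD addrACA -opprD.
have d20 : 0 < d / 2 by rewrite divr_gt0.
have hd' : h <= d / 2 / 4 by move: hd; lra.
have uS : u z i.+1 = u z i + h by rewrite /u xS addrAC.
have vS : v z j.+1 = v z j + h by rewrite /v xS addrAC.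
apply: le_trans (nrmB _ _) _; rewrite mulr_natl mulr2n; apply: lerD.
  apply: (edge_error Kz (pphor_nrm i j)); rewrite pz => far.
  by rewrite uS; exact: edge_h_estimate.
apply: (edge_error Kz (ppver_nrm i j)); rewrite pz => far.
by rewrite [in edge_v _ _ _]vS; exact: edge_v_estimate.
Qed.

End Grid.

Lemma papprox_indicator : (forall a, ~ K a -> papprox K (fun z => (z - a)^-1)) ->
  papprox K (fun z => (chi z)%:C).
Proof.
move=> poles.
suff h : papprox K (fun z => 'i * (2 * pi * chi z)%:C).
  have p0 : (2 * pi)%:C != 0 :> C by rewrite -nrm_eq0 nrm_real normr_eq0 mulf_neq0 ?gt_eqF ?pi_gt0.
  have i0 : 'i != 0 :> C by rewrite -nrm_eq0 nrm_i oner_eq0.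
  apply: (papprox_ext _ (papproxZ ('i * (2 * pi)%:C)^-1 h)) => z _.
  by rewrite (rmorphM _ (2 * pi)) /= [X in _ * X]mulrA mulKf// mulf_neq0.
apply: papprox_lim => e e0.
(* The second bound brings [128 * W ^+ 2 * h / d ^+ 3] down to [e / 2]. *)
pose c := Num.min (d / 8) (e * d ^+ 3 / (256 * W ^+ 2)).
have c0 : 0 < c.
  rewrite lt_min; apply/andP; split; first by rewrite divr_gt0.
  apply: divr_gt0; apply: mulr_gt0; [exact: e0|exact: exprn_gt0| |exact: exprn_gt0].
  by rewrite ltr0n.
pose n := (Num.truncn (2 * W / c)).+1.
have n0 : (0 < n)%N by [].
have hc : 2 * W / n%:R < c.
  by rewrite ltr_pdivrMr ?ltr0n// [c * _]mulrC -ltr_pdivrMr// truncnS_gt.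
move: (hc); rewrite lt_min => /andP[hc1 hc2].
exists (grid_sum n); first exact: (papprox_grid_sum n0 (ltW hc1)).
move=> z Kz; apply: le_lt_trans (grid_sum_estimate n0 (ltW hc1) Kz) _.
apply: (@le_lt_trans _ _ (e / 2)); last by lra.
have W20 : 0 < W ^+ 2 by rewrite exprn_gt0.
have d30 : 0 < d ^+ 3 by rewrite exprn_gt0.
rewrite ler_pdivrMr//.
have -> : e / 2 * d ^+ 3 = 128 * W ^+ 2 * (e * d ^+ 3 / (256 * W ^+ 2)) by field; rewrite gt_eqF.
by rewrite ler_pM2l ?mulr_gt0// ltW.
Qed.

End Indicator.

(** * Polynomials separating one island from the others *)

Section SeparatingPolynomial.
Context {R : realType}.
Local Notation C := R[i].

Lemma separating_polynomial (N : nat) (L : 'I_N -> set C) (j : 'I_N) (e : R) :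
  let K i := closure (jordan_interior (L i)) in
  (forall i, jordan_curve (L i)) -> (forall i, K i !=set0) ->
  (forall i k, i != k -> K i `&` K k = set0) -> 0 < e ->
  exists q : {poly C}, (forall z, K j z -> nrm (q.[z] - 1) < e) /\
    (forall i z, i != j -> K i z -> nrm q.[z] < e).
Proof.
move=> K jL K0 Kdisj e0.
pose A' : set C := [set z | exists2 i, i != j & K i z].
have KE : K j `|` A' = \bigcup_i K i.
  apply/seteqP; split => z; first by move=> [Kz|[i _ Kz]]; [exists j|exists i].
  by move=> [i _ Kz]; have [<-|ij] := eqVneq i j; [left|right; exists i].
have [B B0 KB] := filled_union_bdd jL.
have [d d0 Kd] := filled_separation jL Kdisj.
pose chi z : R := if pselect (K j z) then 1 else 0.
have chi1 z : K j z -> chi z = 1 by rewrite /chi; case: pselect.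
have chi0 z : A' z -> chi z = 0.
  move=> [i ij Kz]; rewrite /chi; case: pselect => // Kj.
  by have : (K i `&` K j) z by []; rewrite Kdisj.
have [|||q hq] := @papprox_indicator R (K j) A' B d chi (K0 j) d0 B0 _ _ chi1 chi0 _ e e0.
- by rewrite KE.
- move=> z w Kz [i ij Kw]; have ji : j != i by rewrite eq_sym.
  exact: (Kd j i ji z w Kz Kw).
- rewrite KE => a Ka; apply: (papprox_pole _ B0 KB) => //.
    exact: filled_union_closed.
  exact: nonvanishing_ext_union.
exists q; split => [z Kz|i z ij Kz].
  by have := hq z (or_introl Kz); rewrite chi1.
have A'z : A' z by exists i.
by have := hq z (or_intror A'z); rewrite chi0// subr0.
Qed.

Lemma sum_binomial (m : nat) : \sum_(i < m.+1) 'C(m, i)%:R = 2 ^+ m :> R.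
Proof.
have := exprDn (1 : R) 1 m; rewrite -[1 + 1]/(2%:R) => ->.
by apply: eq_bigr => i _; rewrite !expr1n mulr1.
Qed.

(* The probability that a binomial variable with parameters [2n] and [t] is at
   least [n]: close to [0] near [t = 0] and to [1] near [t = 1]. *)
Definition majority n : {poly C} :=
  \sum_(i < (2 * n).+1 | (n <= i)%N) 'C(2 * n, i)%:R *: ('X^i * (1 - 'X) ^+ (2 * n - i)).

Lemma size_majority n : (size (majority n) <= (2 * n).+1)%N.
Proof.
apply: (leq_trans (size_sum _ _ _)); apply/bigmax_leqP => i _.
apply: leq_trans (size_scale_leq _ _) _; apply: leq_trans (size_polyMleq _ _) _.
have s1 : size (1 - 'X : {poly C}) = 2 by rewrite -opprB size_polyN size_XsubC.
have := size_poly_exp_leq (1 - 'X : {poly C}) (2 * n - i); rewrite s1 mul1n size_polyXn => h.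
have := ltn_ord i; rewrite ltnS => hi.
by rewrite addSn /= (leq_trans (leq_add (leqnn _) h))// addnS ltnS subnKC.
Qed.

Lemma horner_majority n (t : C) : (majority n).[t] =
  \sum_(i < (2 * n).+1 | (n <= i)%N) t ^+ i * (1 - t) ^+ (2 * n - i) * 'C(2 * n, i)%:R.
Proof.
rewrite horner_sum; apply: eq_bigr => i _.
by rewrite hornerZ hornerM hornerXn horner_exp hornerD hornerN hornerX -polyC1 hornerC mulrC.
Qed.

(** All terms together expand [(t + (1 - t)) ^+ (2 * n) = 1], so the lower tail is what remains. *)
Lemma horner_majorityC n (t : C) : 1 - (majority n).[t] =
  \sum_(i < (2 * n).+1 | (i < n)%N) t ^+ i * (1 - t) ^+ (2 * n - i) * 'C(2 * n, i)%:R.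
Proof.
have E : 1 = \sum_(i < (2 * n).+1) t ^+ i * (1 - t) ^+ (2 * n - i) * 'C(2 * n, i)%:R.
  rewrite -[LHS](expr1n _ (2 * n)) -[X in X ^+ _](subrK t) exprDn.
  by apply: eq_bigr => i _; rewrite -[LHS]mulr_natr [X in X * _ = _]mulrC.
rewrite [X in X - _]E horner_majority (bigID (fun i : 'I__ => (n <= i)%N)) /= addrAC subrr add0r.
by apply: eq_bigl => i; rewrite -ltnNge.
Qed.

Lemma binomial_tail_bound n (P : pred 'I_(2 * n).+1) (t : C) (e : R) : 0 <= e ->
  (forall i, P i -> nrm (t ^+ i * (1 - t) ^+ (2 * n - i)) <= e) ->
  nrm (\sum_(i < (2 * n).+1 | P i) t ^+ i * (1 - t) ^+ (2 * n - i) * 'C(2 * n, i)%:R)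
    <= 4 ^+ n * e.
Proof.
move=> e0 h; apply: le_trans (nrm_sum _ _ _) _.
apply: (@le_trans _ _ (\sum_(i < (2 * n).+1) e * 'C(2 * n, i)%:R)); last first.
  by rewrite -mulr_sumr sum_binomial exprM mulrC -natrX.
rewrite [leRHS](bigID P) /= ler_wpDr ?sumr_ge0// => [i _|]; first by rewrite mulr_ge0.
by apply: ler_sum => i Pi; rewrite nrmM nrm_nat ler_wpM2r// h.
Qed.

(** Each term has at least [n] factors [t] and at most [n] factors [1 - t] of modulus at most 2, and
    the binomial coefficients sum to at most [4 ^+ n]; hence the base [4 * 2 * e]. *)
Lemma majority_near0 n (t : C) (e : R) : e <= 1 -> nrm t <= e ->
  nrm (majority n).[t] <= (8 * e) ^+ n.
Proof.
move=> e1 te; have e0 : 0 <= e by apply: le_trans te; exact: nrm_ge0.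
rewrite horner_majority (_ : 8 * e = 4 * (2 * e)) ?exprMn; last by ring.
apply: binomial_tail_bound => [|i ni]; first by rewrite mulr_ge0 ?exprn_ge0.
have hi : (i <= 2 * n)%N by rewrite -ltnS.
have t1 : nrm (1 - t) <= 2 by have := nrmB 1 t; rewrite Normc.normc1; lra.
rewrite nrmM !nrmX [leRHS]mulrC; apply: ler_pM; rewrite ?exprn_ge0 ?nrm_ge0//.
  apply: (@le_trans _ _ (e ^+ i)); first by rewrite lerXn2r ?nnegrE ?nrm_ge0.
  by apply: ler_wiXn2l.
apply: (@le_trans _ _ (2 ^+ (2 * n - i))); first by rewrite lerXn2r ?nnegrE ?nrm_ge0.
by rewrite ler_eXn2l ?ltr1n// leq_subLR (leq_trans _ (leq_add ni (leqnn n)))// addnn mul2n.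
Qed.

Lemma majority_near1 n (t : C) (e : R) : e <= 1 -> nrm (1 - t) <= e ->
  nrm (1 - (majority n).[t]) <= (8 * e) ^+ n.
Proof.
move=> e1 te; have e0 : 0 <= e by apply: le_trans te; exact: nrm_ge0.
rewrite horner_majorityC (_ : 8 * e = 4 * (2 * e)) ?exprMn; last by ring.
apply: binomial_tail_bound => [|i ni]; first by rewrite mulr_ge0 ?exprn_ge0.
have t1 : nrm t <= 2.
  by have := nrmB 1 (1 - t); rewrite Normc.normc1 opprB addrC subrK; lra.
rewrite nrmM !nrmX; apply: ler_pM; rewrite ?exprn_ge0 ?nrm_ge0//.
  apply: (@le_trans _ _ (2 ^+ i)); first by rewrite lerXn2r ?nnegrE ?nrm_ge0.
  by rewrite ler_eXn2l ?ltr1n// ltnW.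
apply: (@le_trans _ _ (e ^+ (2 * n - i))); first by rewrite lerXn2r ?nnegrE ?nrm_ge0.
have hi : (i <= 2 * n)%N by rewrite -ltnS.
by apply: ler_wiXn2l => //; rewrite leq_subRL// (leq_trans (leq_add (ltnW ni) (leqnn n)))// addnn mul2n.
Qed.

End SeparatingPolynomial.

(** * Orthogonal polynomials *)

Section AreaMeasure.
Context {R : realType}.
Local Notation C := R[i].
Local Notation T := (measurableTypeR R * measurableTypeR R)%type.
Local Notation mu := (@area_measure R).

(** The boxes with rational centre and radius contained in [U] are countably many and cover it. *)
Lemma open_measurable_prod (U : set (R * R)) : open U -> measurable (U : set T).
Proof.
move=> oU.
pose box (a b r : rat) : set T :=
  `](ratr a - ratr r), (ratr a + ratr r)[%classic `*` `](ratr b - ratr r), (ratr b + ratr r)[%classic.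
pose F a b r : set T := if pselect (box a b r `<=` U) then box a b r else set0.
have -> : U = \bigcup_a \bigcup_b \bigcup_r F a b r.
  apply/seteqP; split => [[x y] Uxy|w [a _ [b _ [r _]]]]; last first.
    by rewrite /F; case: pselect => [BU|//]; exact: BU.
  move: oU; rewrite openE => /(_ _ Uxy) /nbhs_ballP[e /= e0 eU].
  have [r] : exists r : rat, (0 : R) < ratr r < e / 2.
    have [|r] := @rat_in_itvoo R 0 (e / 2); first by rewrite divr_gt0.
    by rewrite in_itv => h; exists r.
  move=> /andP[r0 re].
  have [|a] := @rat_in_itvoo R (x - ratr r) (x + ratr r); first by lra.
  rewrite in_itv /= => /andP[a1 a2].
  have [|b] := @rat_in_itvoo R (y - ratr r) (y + ratr r); first by lra.
  rewrite in_itv /= => /andP[b1 b2].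
  exists a => //; exists b => //; exists r => //; rewrite /F; case: pselect => [BU /=|[]].
    by split; rewrite /= in_itv /=; apply/andP; split; lra.
  move=> [x' y'] [] /=; rewrite !in_itv /= => /andP[x1 x2] /andP[y1 y2]; apply: eU.
  by split; rewrite /ball /= ltr_norml; apply/andP; split; lra.
apply: bigcupT_measurable_rat => a; apply: bigcupT_measurable_rat => b.
apply: bigcupT_measurable_rat => r; rewrite /F; case: pselect => [BU|nBU] /=; last exact: measurable0.
by apply: measurableX; exact: measurable_itv.
Qed.

Lemma continuous_measurable_prod (h : R * R -> R) (D : set T) :
  continuous h -> measurable D -> measurable_fun D (h : T -> R).
Proof.
move=> ch mD; apply: (measurability _ (RGenOpens.measurableE R)).
move=> _ [_ [a [b ->] <-]]; apply: measurableI => //.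
by apply: open_measurable_prod; move/continuousP : ch; apply; exact: interval_open.
Qed.

Definition square (M : R) : set T := `[(- M), M]%classic `*` `[(- M), M]%classic.

Definition bounded_measurable (D : set T) := measurable D /\ exists M, D `<=` square M.

Lemma rectangle_measure (a b c d : R) : a <= b -> c <= d ->
  mu (`[a, b]%classic `*` `[c, d]%classic) = ((b - a) * (d - c))%:E.
Proof.
have itvE (x y : R) : x <= y -> lebesgue_measure (`[x, y]%classic : set R) = (y - x)%:E.
  move=> xy; rewrite lebesgue_measure_itv /= lte_fin.
  by move: xy; rewrite le_eqVlt => /predU1P[->|->]; rewrite ?ltxx ?subrr// -EFinB.
move=> ab cd; rewrite EFinM -(itvE _ _ ab) -(itvE _ _ cd).
by apply: product_measure1E; exact: measurable_itv.
Qed.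

Lemma bmeas_finite D : bounded_measurable D -> (mu D < +oo)%E.
Proof.
move=> [mD [M DM]]; have mS : measurable (square `|M| : set T).
  by apply: measurableX; exact: measurable_itv.
apply: (@le_lt_trans _ _ (mu (square `|M|))).
  apply: le_measure; rewrite ?inE// => w /DM[] /=; rewrite !in_itv /= => /andP[h1 h2] /andP[h3 h4].
  have h := ler_norm M.
  by split; rewrite /= in_itv /=; apply/andP; split; lra.
rewrite rectangle_measure ?ltry//; have := normr_ge0 M; lra.
Qed.

Lemma bmeas_integrable D (h : R * R -> R) : bounded_measurable D -> continuous h ->
  mu.-integrable D (EFin \o (h : T -> R)).
Proof.
move=> gD ch; have [mD [M DM]] := gD.
apply: measurable_bounded_integrable => //; first exact: bmeas_finite.
  exact: continuous_measurable_prod.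
have : compact (h @` (square M)).
  apply: continuous_compact; first exact: continuous_subspaceT.
  by apply: compact_setX; exact: segment_compact.
move=> /compact_bounded[B [Breal hB]]; exists B; split => // x Bx z Dz.
by apply: (hB x Bx); exists z => //; exact: DM.
Qed.

Lemma bmeas_rectangle (a b c d : R) : bounded_measurable (`[a, b]%classic `*` `[c, d]%classic).
Proof.
split; first by apply: measurableX; exact: measurable_itv.
exists (`|a| + `|b| + `|c| + `|d|) => w [] /=; rewrite !in_itv /= => /andP[h1 h2] /andP[h3 h4].
have := lerNnormlW (lexx `|a|); have := lerNnormlW (lexx `|c|).
have := ler_norm b; have := ler_norm d.
have := normr_ge0 a; have := normr_ge0 b; have := normr_ge0 c; have := normr_ge0 d => *.
by split; rewrite /= in_itv /=; apply/andP; split; lra.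
Qed.

Lemma bmeas_setD D E : bounded_measurable D -> bounded_measurable E -> bounded_measurable (E `\` D).
Proof.
move=> [mD _] [mE [M EM]]; split; first exact: measurableD.
by exists M => w [/EM].
Qed.

Lemma bmeas_split D E (h : R * R -> R) : bounded_measurable D -> bounded_measurable E -> D `<=` E -> continuous h ->
  \int[mu]_(w in E) h w = \int[mu]_(w in D) h w + \int[mu]_(w in E `\` D) h w.
Proof.
move=> gD gE DE ch; have [mD _] := gD; have [mE _] := gE; have [mED _] := bmeas_setD gD gE.
rewrite -[in LHS](setDUK DE); apply: Rintegral_setU => //.
  by rewrite setDUK//; exact: bmeas_integrable.
by apply/disj_setPS => w [? []].
Qed.

Lemma bmeas_subset_le D E (h : R * R -> R) : bounded_measurable D -> bounded_measurable E -> D `<=` E -> continuous h ->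
  (forall w, 0 <= h w) -> \int[mu]_(w in D) h w <= \int[mu]_(w in E) h w.
Proof.
move=> gD gE DE ch h0; rewrite (bmeas_split gD gE DE ch) lerDl.
exact: Rintegral_ge0.
Qed.

(** Shaped for the product of an extremal and a separating polynomial: comparison with the extremal
    one on its own island [D], and a uniform bound, paid for by area, on the other islands. *)
Lemma bmeas_split_le D E (h g : R * R -> R) (c M : R) : bounded_measurable D -> bounded_measurable E -> D `<=` E ->
  continuous h -> continuous g -> 0 <= M ->
  (forall w, D w -> h w <= c * g w) -> (forall w, E w -> ~ D w -> h w <= M) ->
  \int[mu]_(w in E) h w <= c * (\int[mu]_(w in D) g w) + M * fine (mu E).
Proof.
move=> gD gE DE ch cg M0 hg hM; rewrite (bmeas_split gD gE DE ch).
have [mD _] := gD; have gED := bmeas_setD gD gE; have [mED _] := gED.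
apply: lerD.
  rewrite -RintegralZl//; last exact: bmeas_integrable.
  apply: le_Rintegral => //; [exact: bmeas_integrable|].
  apply: bmeas_integrable => //; apply: contM; [exact: cont_cst|exact: cg].
apply: (@le_trans _ _ (\int[mu]_(w in E `\` D) M)).
  apply: le_Rintegral => //; [exact: bmeas_integrable| |by move=> w [Ew Dw]; exact: hM].
  by apply: bmeas_integrable => //; exact: cont_cst.
rewrite Rintegral_cst//; apply: ler_wpM2l => //; apply: fine_le.
- by rewrite ge0_fin_numE// bmeas_finite.
- by rewrite ge0_fin_numE// bmeas_finite.
- by apply: le_measure; rewrite ?inE//; case: gE.
Qed.

(** A minimum does not exceed the mean. The lemma turns an integral bound into a pointwise bound at
    one point of each prescribed rectangle, which supplies interpolation nodes. *)
Lemma rectangle_min (a b c d : R) D (h : R * R -> R) : a <= b -> c <= d -> bounded_measurable D ->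
  `[a, b]%classic `*` `[c, d]%classic `<=` D -> continuous h -> (forall w, 0 <= h w) ->
  exists2 w : R * R, (`[a, b]%classic `*` `[c, d]%classic) w &
    h w * ((b - a) * (d - c)) <= \int[mu]_(w in D) h w.
Proof.
move=> ab cd gD SD ch h0; set S := _ `*` _.
have S0 : S !=set0.
  by exists (a, c); split => /=; rewrite in_itv /= lexx.
have [||w] := @compact_EVT_min _ R h S S0.
- by apply: compact_setX; exact: segment_compact.
- exact: continuous_subspaceT.
rewrite inE => Sw hw; exists w => //.
have gS : bounded_measurable S by exact: bmeas_rectangle.
apply: le_trans (bmeas_subset_le gS gD SD ch h0).
have -> : h w * ((b - a) * (d - c)) = \int[mu]_(x in S) (h w).
  by rewrite Rintegral_cst; [rewrite rectangle_measure|case: gS].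
apply: le_Rintegral; [by case: gS| |exact: bmeas_integrable|].
  by apply: bmeas_integrable => //; exact: cont_cst.
by move=> x Sx; apply: hw; rewrite inE.
Qed.

End AreaMeasure.

(** Lagrange's identity: the difference of the two sides is half the double sum of
    [(a i * b j - a j * b i) ^+ 2]. *)
Lemma cauchy_schwarz_sum (R : realFieldType) (n : nat) (a b : 'I_n -> R) :
  (\sum_k a k * b k) ^+ 2 <= (\sum_k a k ^+ 2) * (\sum_k b k ^+ 2).
Proof.
have h : 0 <= \sum_i \sum_j (a i * b j - a j * b i) ^+ 2.
  by apply: sumr_ge0 => i _; apply: sumr_ge0 => j _; exact: sqr_ge0.
have E : \sum_i \sum_j (a i * b j - a j * b i) ^+ 2 =
    2 * ((\sum_k a k ^+ 2) * (\sum_k b k ^+ 2) - (\sum_k a k * b k) ^+ 2).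
  rewrite (eq_bigr (fun i => \sum_j (a i ^+ 2 * b j ^+ 2 + b i ^+ 2 * a j ^+ 2
     - 2 * ((a i * b i) * (a j * b j))))); last first.
    by move=> i _; apply: eq_bigr => j _; ring.
  rewrite (eq_bigr (fun i => a i ^+ 2 * (\sum_j b j ^+ 2) + b i ^+ 2 * (\sum_j a j ^+ 2)
     - 2 * ((a i * b i) * (\sum_j a j * b j)))); last first.
    by move=> i _; rewrite sumrB big_split /= -!mulr_sumr.
  rewrite sumrB big_split /= -mulr_sumr -!mulr_suml; ring.
by move: h; rewrite E pmulr_rge0// subr_ge0.
Qed.

(** * Orthonormal expansions and the extremal property *)

Section OrthonormalPolynomials.
Context {R : realType}.
Local Notation C := R[i].
Local Notation mu := (@area_measure R).
Implicit Types (D : set C) (f g : C -> C) (p q : {poly C}).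

Definition slice D : set (R * R) := [set w | D (w.1 +i* w.2)].

Let cpair := @complex_pair_continuous R.

Let intRe f : continuous f -> continuous (fun w : R * R => cRe (f (w.1 +i* w.2))).
Proof. by move=> cf; apply: (cont_comp (cont_comp cpair cf) (@Re_continuous R)). Qed.

Let intIm f : continuous f -> continuous (fun w : R * R => cIm (f (w.1 +i* w.2))).
Proof. by move=> cf; apply: (cont_comp (cont_comp cpair cf) (@Im_continuous R)). Qed.

Lemma area_integralD D f g : bounded_measurable (slice D) -> continuous f -> continuous g ->
  area_integral D (fun z => f z + g z) = area_integral D f + area_integral D g.
Proof.
move=> gD cf cg; have [mD _] := gD; rewrite /area_integral -/(slice D).
have -> : (fun w : R * R => cRe (f (w.1 +i* w.2) + g (w.1 +i* w.2))) =
   (fun w => cRe (f (w.1 +i* w.2)) + cRe (g (w.1 +i* w.2))) by apply/funext => w; rewrite ReD.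
have -> : (fun w : R * R => cIm (f (w.1 +i* w.2) + g (w.1 +i* w.2))) =
   (fun w => cIm (f (w.1 +i* w.2)) + cIm (g (w.1 +i* w.2))) by apply/funext => w; rewrite ImD.
rewrite RintegralD//; [|exact: (bmeas_integrable gD (intRe cf))|exact: (bmeas_integrable gD (intRe cg))].
by rewrite RintegralD//; [exact: (bmeas_integrable gD (intIm cf))|exact: (bmeas_integrable gD (intIm cg))].
Qed.

Lemma area_integralZ D c f : bounded_measurable (slice D) -> continuous f ->
  area_integral D (fun z => c * f z) = c * area_integral D f.
Proof.
move=> gD cf; have [mD _] := gD; rewrite /area_integral -/(slice D); case: c => a b.
have iRe := bmeas_integrable gD (intRe cf); have iIm := bmeas_integrable gD (intIm cf).
have h r : continuous (fun w : R * R => r * cRe (f (w.1 +i* w.2))).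
  by apply: contM; [exact: cont_cst|exact: intRe].
have h' r : continuous (fun w : R * R => r * cIm (f (w.1 +i* w.2))).
  by apply: contM; [exact: cont_cst|exact: intIm].
have -> : (fun w : R * R => cRe ((a +i* b) * f (w.1 +i* w.2))) =
   (fun w => a * cRe (f (w.1 +i* w.2)) + (- b) * cIm (f (w.1 +i* w.2))).
  by apply/funext => w; case: (f _) => u v /=; rewrite mulNr.
have -> : (fun w : R * R => cIm ((a +i* b) * f (w.1 +i* w.2))) =
   (fun w => a * cIm (f (w.1 +i* w.2)) + b * cRe (f (w.1 +i* w.2))).
  by apply/funext => w; case: (f _) => u v /=.
rewrite RintegralD//; [|exact: (bmeas_integrable gD (h _))|exact: (bmeas_integrable gD (h' _))].
rewrite RintegralD//; [|exact: (bmeas_integrable gD (h' _))|exact: (bmeas_integrable gD (h _))].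
rewrite !RintegralZl//.
by apply/eqP; rewrite eq_complex /= mulNr !eqxx.
Qed.

Lemma area_integral_conj D f : bounded_measurable (slice D) -> continuous f ->
  area_integral D (fun z => (f z)^*) = (area_integral D f)^*.
Proof.
move=> gD cf; have [mD _] := gD; rewrite /area_integral -/(slice D).
have -> : (fun w : R * R => cRe ((f (w.1 +i* w.2))^*)) = (fun w => cRe (f (w.1 +i* w.2))).
  by apply/funext => w; case: (f _).
have -> : (fun w : R * R => cIm ((f (w.1 +i* w.2))^*)) = (fun w => (-1) * cIm (f (w.1 +i* w.2))).
  by apply/funext => w; case: (f _) => a b; rewrite mulN1r.
by rewrite RintegralZl//; [rewrite mulN1r|exact: (bmeas_integrable gD (intIm cf))].
Qed.

Definition nsq D p : R := \int[mu]_(w in slice D) (nrm p.[w.1 +i* w.2]) ^+ 2.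

Lemma nsq_continuous p : continuous (fun w : R * R => nrm p.[w.1 +i* w.2] ^+ 2).
Proof.
have c : continuous (fun w : R * R => nrm p.[w.1 +i* w.2]).
  exact: (cont_comp (cont_comp cpair (@horner_continuousC R p)) (@nrm_continuous R)).
exact: (contM c c).
Qed.

Lemma L2_inner_nsq D p : L2_inner D (horner p) (horner p) = (nsq D p)%:C.
Proof.
rewrite /L2_inner /area_integral -/(slice D).
have -> : (fun w : R * R => cRe (p.[w.1 +i* w.2] * (p.[w.1 +i* w.2])^*)) =
  (fun w => nrm p.[w.1 +i* w.2] ^+ 2) by apply/funext => w; rewrite mul_conj.
have -> : (fun w : R * R => cIm (p.[w.1 +i* w.2] * (p.[w.1 +i* w.2])^*)) = (fun=> 0).
  by apply/funext => w; rewrite mul_conj.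
by rewrite (_ : \int[mu]_(w in _) 0 = 0)// /Rintegral integral0.
Qed.

Lemma L2_inner_continuous p q : continuous (fun z : C => p.[z] * (q.[z])^*).
Proof.
apply: contM; first exact: horner_continuousC.
exact: (cont_comp (@horner_continuousC R q) (@conj_continuous R)).
Qed.

Lemma L2_innerZD D c p q r : bounded_measurable (slice D) ->
  L2_inner D (horner (c *: p + q)) (horner r) =
  c * L2_inner D (horner p) (horner r) + L2_inner D (horner q) (horner r).
Proof.
move=> gD; rewrite /L2_inner -area_integralZ//; last exact: L2_inner_continuous.
rewrite -area_integralD//; last exact: L2_inner_continuous.
  by congr area_integral; apply/funext => z; rewrite hornerD hornerZ mulrDl mulrA.
by apply: contM; [exact: cont_cst|exact: L2_inner_continuous].
Qed.

Lemma L2_inner_sum D n (c : 'I_n -> C) (P : 'I_n -> {poly C}) r : bounded_measurable (slice D) ->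
  L2_inner D (horner (\sum_k c k *: P k)) (horner r) =
  \sum_k c k * L2_inner D (horner (P k)) (horner r).
Proof.
move=> gD.
apply: (big_rec2 (fun p x => L2_inner D (horner p) (horner r) = x)).
  have := L2_innerZD (-1) r r r gD; rewrite mulN1r scaleN1r addNr => ->.
  by rewrite addNr.
by move=> k p x _ <-; rewrite L2_innerZD.
Qed.

Lemma L2_inner_conj D p q : bounded_measurable (slice D) ->
  L2_inner D (horner q) (horner p) = (L2_inner D (horner p) (horner q))^*.
Proof.
move=> gD; rewrite /L2_inner -area_integral_conj//; last exact: L2_inner_continuous.
by congr area_integral; apply/funext => z; rewrite rmorphM /= conjcK mulrC.
Qed.

Context (D : set C) (P : nat -> {poly C}).
Hypotheses (gD : bounded_measurable (slice D)) (hP : bergman_polynomials D P).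

Lemma nsq_combination n (c : 'I_n -> C) : nsq D (\sum_k c k *: P k) = \sum_k nrm (c k) ^+ 2.
Proof.
have [_ _ hort] := hP; apply: (@complexI R); rewrite -L2_inner_nsq L2_inner_sum//.
rewrite rmorph_sum /=; apply: eq_bigr => k _; rewrite -mul_conj; congr (_ * _).
rewrite L2_inner_conj// L2_inner_sum//; congr (_^*).
rewrite (bigD1 k)//= hort eqxx mulr1 big1 ?addr0// => l lk.
by rewrite hort (negPf (_ : val l != val k))// mulr0.
Qed.

Lemma combination_exists n p : (size p <= n)%N -> exists c : 'I_n -> C, p = \sum_k c k *: P k.
Proof.
have [sP lP _] := hP; elim: n p => [|n IHn] p sp.
  exists (fun=> 0); rewrite big_ord0; apply/eqP; by rewrite -size_poly_leq0.
pose a := p`_n / lead_coef (P n).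
have lP0 : lead_coef (P n) != 0 by rewrite gt_eqF.
have [|c hc] := IHn (p - a *: P n).
  apply/leq_sizeP => k; rewrite leq_eqVlt => /predU1P[<-|nk].
    have -> : (p - a *: P n)`_n = p`_n - a * lead_coef (P n).
      by rewrite coefB coefZ lead_coefE sP.
    by rewrite /a divfK// subrr.
  rewrite coefB coefZ !nth_default ?mulr0 ?subr0// ?sP//.
  exact: leq_trans sp nk.
exists (fun k => if unlift ord_max k is Some j then c j else a).
rewrite big_ord_recr /= unlift_none -[LHS](subrK (a *: P n)) hc; congr (_ + _).
apply: eq_bigr => k _.
suff -> : unlift ord_max (widen_ord (leqnSn n) k) = Some k by [].
by rewrite -[RHS](liftK ord_max); congr unlift; apply/val_inj; rewrite /= /bump leqNgt ltn_ord.
Qed.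

(** For orthonormal [P], the value at (z, z) of the reproducing kernel of the polynomials of degree
    at most [n]. *)
Definition kernel_diag (P : nat -> {poly C}) n z : R := \sum_(k < n.+1) nrm (P k).[z] ^+ 2.

Lemma kernel_diag_gt0 n z : 0 < kernel_diag P n z.
Proof.
have [sP lP _] := hP; rewrite /kernel_diag big_ord_recl ltr_pwDl ?sumr_ge0//.
  rewrite exprn_gt0// nrm_gt0 /=; have /size_poly1P[c c0 ->] : size (P 0%N) == 1%N by rewrite sP.
  by rewrite hornerC.
by move=> i _; rewrite exprn_ge0// nrm_ge0.
Qed.

(** Cauchy-Schwarz for the coefficients of [p] in the orthonormal basis. *)
Lemma nrm_eval_le n p z : (size p <= n.+1)%N -> nrm p.[z] ^+ 2 <= nsq D p * kernel_diag P n z.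
Proof.
move=> /combination_exists[c ->]; rewrite nsq_combination horner_sum.
apply: (le_trans _ (cauchy_schwarz_sum _ _)).
rewrite lerXn2r ?nnegrE ?nrm_ge0 ?sumr_ge0// => [k _|]; first by rewrite mulr_ge0 ?nrm_ge0.
by apply: le_trans (nrm_sum _ _ _) _; apply: ler_sum => k _; rewrite hornerZ nrmM.
Qed.

(** The witness is the reproducing kernel with second argument [z], for which [nrm_eval_le] is an
    equality. *)
Lemma kernel_poly n z : exists p : {poly C}, [/\ (size p <= n.+1)%N,
  nrm p.[z] = kernel_diag P n z & nsq D p = kernel_diag P n z].
Proof.
have [sP _ _] := hP.
exists (\sum_(k < n.+1) ((P k).[z])^* *: P k); split.
- apply: leq_trans (size_sum _ _ _) _; apply/bigmax_leqP => k _.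
  by apply: leq_trans (size_scale_leq _ _) _; rewrite sP.
- rewrite horner_sum (eq_bigr (fun k : 'I_n.+1 => (nrm (P k).[z] ^+ 2)%:C)); last first.
    by move=> k _; rewrite hornerZ mulrC mul_conj.
  rewrite -rmorph_sum /= nrm_real ger0_norm// sumr_ge0// => k _.
  by rewrite exprn_ge0// nrm_ge0.
- by rewrite nsq_combination; apply: eq_bigr => k _; rewrite nrm_conj.
Qed.

Lemma sqrt_christoffelE n z : sqrt_christoffel P n z = (Num.sqrt (kernel_diag P n z))^-1.
Proof. by []. Qed.

End OrthonormalPolynomials.

(** * Interpolation and the growth of polynomials *)

(** The product of the integers from n + 1 to 2n has [n] factors at least [n.+1]; it equals n! times
    a central binomial coefficient, which is at most [4 ^ n]. *)
Lemma expn_le_fact n : (n.+1 ^ n <= 4 ^ n * n`!)%N.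
Proof.
have h1 : (n.+1 ^ n <= (2 * n) ^_ n)%N.
  rewrite ffact_prod -[X in (_ ^ X <= _)%N]card_ord -prod_nat_const.
  apply: leq_prod => i _; rewrite leq_subRL; last first.
    by apply: leq_trans (ltnW (ltn_ord i)) _; rewrite mul2n -addnn leq_addr.
  by rewrite mul2n -addnn addnS -addSn leq_add2r.
apply: leq_trans h1 _; rewrite -bin_ffact leq_mul2r; apply/orP; right.
have hn : (n < (2 * n).+1)%N by rewrite ltnS mul2n -addnn leq_addr.
rewrite (_ : 4 ^ n = (1 + 1) ^ (2 * n))%N; last by rewrite expnM.
by rewrite Pascal (bigD1 (Ordinal hn)) //= !exp1n !muln1 leq_addr.
Qed.

Lemma prod_dist_fact (R : realDomainType) n k : (k <= n)%N ->
  \prod_(l < n.+1 | l != k :> nat) `|k%:R - l%:R| = (k`! * (n - k)`!)%:R :> R.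
Proof.
pose F l : R := if l != k then `|k%:R - l%:R| else 1.
have below m : (m <= k)%N -> (\prod_(0 <= l < m) F l) * (k - m)`!%:R = k`!%:R.
  elim: m => [|m IHm] mk; first by rewrite big_geq// mul1r subn0.
  rewrite big_nat_recr//= -IHm ?(ltnW mk)// -mulrA; congr (_ * _).
  rewrite /F ltn_eqF// -natrB ?(ltnW mk)// ger0_norm// -natrM.
  by rewrite [in RHS](_ : k - m = (k - m.+1).+1)%N ?factS// subnSK.
have above j : \prod_(0 <= l < (k + j).+1) F l = (k`! * j`!)%:R.
  elim: j => [|j IHj].
    rewrite addn0 big_nat_recr//= /F eqxx /= mulr1 fact0 muln1.
    by have := below k (leqnn k); rewrite subnn fact0 mulr1.
  rewrite addnS big_nat_recr//= IHj /F gtn_eqF ?ltnS ?leq_addr// distrC -natrB; last first.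
    by rewrite ltnW// ltnS leq_addr.
  by rewrite ger0_norm// -addnS addKn -natrM -mulnA factS [(j.+1 * _)%N]mulnC.
move=> kn; have := above (n - k)%N; rewrite subnKC// => <-.
by rewrite big_mkcond big_mkord.
Qed.

Section Lagrange.
Context {R : realType}.
Local Notation C := R[i].
Variables (n : nat) (x : 'I_n.+1 -> C).
Hypothesis x_inj : injective x.

Definition lagrange_basis (k : 'I_n.+1) : {poly C} :=
  \prod_(l | l != k) ((x k - x l)^-1 *: ('X - (x l)%:P)).

Lemma lagrange_basisE k j : (lagrange_basis k).[x j] = (j == k)%:R.
Proof.
rewrite horner_prod; have [->|jk] := eqVneq j k.
  rewrite big1 // => l lk; rewrite hornerZ hornerXsubC mulVf// subr_eq0.
  by apply: contra lk => /eqP/x_inj ->.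
by rewrite (bigD1 j)//= hornerZ hornerXsubC subrr mulr0 mul0r.
Qed.

Lemma size_lagrange_basis k : (size (lagrange_basis k) <= n.+1)%N.
Proof.
apply: leq_trans (size_prod_leq _ _) _.
have cP : #|[pred l | l != k]| = n by rewrite cardC1 card_ord.
have : (\sum_(l | l != k) size ((x k - x l)^-1 *: ('X - (x l)%:P)) <= 2 * n)%N.
  rewrite -[X in (_ <= _ * X)%N]cP mulnC -sum_nat_const; apply: leq_sum => l _.
  by apply: leq_trans (size_scale_leq _ _) _; rewrite size_XsubC.
rewrite cP => h; rewrite leq_subLR addnS ltnS; apply: leq_trans h _.
by rewrite mul2n addnn.
Qed.

Lemma lagrange_interpolation (p : {poly C}) : (size p <= n.+1)%N ->
  p = \sum_k p.[x k] *: lagrange_basis k.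
Proof.
move=> sp; apply/eqP; rewrite -subr_eq0; apply/eqP.
apply: (@roots_geq_poly_eq0 _ _ [seq x k | k <- enum 'I_n.+1]).
- apply/allP => _ /mapP[j _ ->]; rewrite /root hornerD hornerN horner_sum.
  rewrite (bigD1 j)//= hornerZ lagrange_basisE eqxx mulr1 big1 ?addr0 ?subrr// => k kj.
  by rewrite hornerZ lagrange_basisE eq_sym (negPf kj) mulr0.
- by rewrite map_inj_uniq ?enum_uniq.
- rewrite size_map size_enum_ord; apply: leq_trans (size_polyD _ _) _.
  rewrite geq_max sp size_polyN; apply: leq_trans (size_sum _ _ _) _.
  apply/bigmax_leqP => k _; apply: leq_trans (size_scale_leq _ _) _.
  exact: size_lagrange_basis.
Qed.

End Lagrange.

Section PolynomialGrowth.
Context {R : realType}.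
Local Notation C := R[i].
Local Notation mu := (@area_measure R).

(** The nodes are at least as spread out as equally spaced ones, so the denominators of the Lagrange
    basis are at least t^n k! (n - k)!, and the inverses of k! (n - k)! sum to 2^n / n!. *)
Lemma lagrange_bound n (x : 'I_n.+1 -> C) (p : {poly C}) (z : C) (t B m : R) :
  (size p <= n.+1)%N -> 0 < t -> 0 <= B ->
  (forall k l : 'I_n.+1, `|k%:R - l%:R| * t <= nrm (x k - x l)) ->
  (forall k, nrm p.[x k] <= m) -> (forall k, nrm (z - x k) <= B) ->
  nrm p.[z] <= m * ((2 * B / t) ^+ n / n`!%:R).
Proof.
move=> sp t0 B0 xsep pm zB.
have xinj : injective x.
  move=> k l xkl; have := xsep k l; rewrite xkl subrr Normc.normc0 pmulr_lle0//.
  rewrite normr_le0 subr_eq0 eqr_nat => /eqP kl; exact/val_inj.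
have m0 : 0 <= m by apply: le_trans (pm ord0); exact: nrm_ge0.
rewrite [in leLHS](lagrange_interpolation xinj sp) horner_sum.
apply: le_trans (nrm_sum _ _ _) _.
apply: (@le_trans _ _ (\sum_(k < n.+1) m * ((B / t) ^+ n / (k`! * (n - k)`!)%:R))).
  apply: ler_sum => k _; rewrite hornerZ nrmM; apply: ler_pM; rewrite ?nrm_ge0//.
  rewrite /lagrange_basis horner_prod.
  have -> : nrm (\prod_(l | l != k) ((x k - x l)^-1 *: ('X - (x l)%:P)).[z]) =
     \prod_(l | l != k) (nrm (z - x l) / nrm (x k - x l)).
    elim/big_rec2: _ => [|l y w _ IH]; first by rewrite Normc.normc1.
    by rewrite nrmM IH hornerZ hornerXsubC nrmM nrmV mulrC [_^-1 * _]mulrC mulrC.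
  apply: (@le_trans _ _ (\prod_(l < n.+1 | l != k) ((B / t) / `|k%:R - l%:R|))).
    apply: ler_prod => l lk; rewrite divr_ge0 ?nrm_ge0//=.
    have kl : 0 < `|k%:R - l%:R| :> R.
      by rewrite normr_gt0 subr_eq0 eqr_nat eq_sym.
    rewrite -mulrA -invfM; apply: ler_pM; rewrite ?nrm_ge0 ?invr_ge0 ?nrm_ge0//.
    rewrite lef_pV2 ?posrE ?mulr_gt0//; first by rewrite mulrC.
    by rewrite (lt_le_trans _ (xsep k l))// mulr_gt0.
  rewrite big_split /= prodr_const cardC1 card_ord /=; apply: ler_wpM2l.
    by rewrite exprn_ge0// divr_ge0// ltW.
  rewrite prodfV /= (@prod_dist_fact R n k)//.
  by rewrite -ltnS.
rewrite -mulr_sumr; apply: ler_wpM2l => //; rewrite -mulr_sumr.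
have -> : (2 * B / t) ^+ n / n`!%:R = (B / t) ^+ n * (2 ^+ n / n`!%:R).
  by rewrite (_ : 2 * B / t = (B / t) * 2) ?(exprMn _ (B / t)) ?mulrA//; ring.
apply: ler_wpM2l; first by rewrite exprn_ge0// divr_ge0// ltW.
rewrite -(@sum_binomial R n) mulr_suml; apply: ler_sum => k _.
have kn : (k <= n)%N by rewrite -ltnS.
have binn0 : 'C(n, k)%:R != 0 :> R by rewrite pnatr_eq0 -lt0n bin_gt0.
by rewrite -(bin_fact kn) [in leRHS]natrM invfM mulrA divff// mul1r.
Qed.

(** A crude Bernstein-Walsh inequality. The square is cut into [2 * n.+1] vertical strips of width
    [t]; every second one contains a point where the squared modulus of [p] is at most
    [nsq D p / (t * s)], and [p] is interpolated at these points. The power of [t] in the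
    denominator is compensated by the factorial in [lagrange_bound]. *)
Lemma polynomial_growth (D : set C) (a c s B : R) : bounded_measurable (slice D) -> 0 < s ->
  `[a, a + s]%classic `*` `[c, c + s]%classic `<=` slice D ->
  (forall z, D z -> nrm z <= B) ->
  exists K rho : R, [/\ 1 <= K, 1 <= rho &
    forall (n : nat) (p : {poly C}) (z : C), (size p <= n.+1)%N -> nrm z <= B ->
      nrm p.[z] ^+ 2 <= K * rho ^+ n * nsq D p].
Proof.
move=> gD s0 SD DB.
have Dac : D (a +i* c).
  by apply: (SD (a, c)); split; rewrite /= in_itv /= lexx lerDl ltW.
have B0 : 0 <= B by apply: le_trans (DB _ Dac); exact: nrm_ge0.
(* [32] is [8 * 4]: the quotient [2 * (2 * B) / t] equals [8 * B / s * n.+1], and [expn_le_fact]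
   turns the powers of [n.+1] into powers of 4. Since [(t * s)^-1] is [2 / s ^+ 2 * n.+1], the
   factor 2 in [rho] absorbs [n.+1]. *)
pose K := Num.max 1 (2 / s ^+ 2); pose rho := Num.max 1 (2 * (32 * B / s) ^+ 2).
have K1 : 1 <= K by rewrite le_max lexx.
have rho1 : 1 <= rho by rewrite le_max lexx.
exists K, rho; split => // n p z sp zB.
pose t := s / (2 * n.+1%:R).
have n0 : (0 : R) < n.+1%:R by rewrite ltr0n.
have t0 : 0 < t by rewrite divr_gt0// mulr_gt0.
have tn : 2 * n.+1%:R * t = s by rewrite mulrC divfK// gt_eqF// mulr_gt0.
have nsq0 : 0 <= nsq D p by apply: Rintegral_ge0 => w _; exact: exprn_ge0 (nrm_ge0 _).
pose m := Num.sqrt (nsq D p / (t * s)).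
have m2 : m ^+ 2 = nsq D p / (t * s) by rewrite sqr_sqrtr// divr_ge0// ltW// mulr_gt0.
have E1 (k : nat) : (2 * k)%:R = 2 * k%:R :> R by rewrite natrM.
have E2 (k : nat) : (2 * k + 1)%:R = 2 * k%:R + 1 :> R by rewrite natrD natrM.
have /choice[w hw] : forall k : 'I_n.+1, exists w : R * R,
    (a + (2 * k)%:R * t <= w.1 <= a + (2 * k + 1)%:R * t) /\
    D (w.1 +i* w.2) /\ nrm p.[w.1 +i* w.2] <= m.
  move=> k.
  have kn : k%:R + 1 <= n.+1%:R :> R by rewrite -natr1 lerD2r ler_nat -ltnS.
  have k0 : 0 <= k%:R :> R by [].
  have SkD : `[a + (2 * k)%:R * t, a + (2 * k + 1)%:R * t]%classic `*` `[c, c + s]%classic `<=` slice D.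
    move=> w [] /=; rewrite !in_itv /= => /andP[h1 h2] h3; apply: SD; split => //=.
    rewrite in_itv /=; move: h1 h2; rewrite E2 E1; nra.
  have h0 (v : R * R) : 0 <= nrm p.[v.1 +i* v.2] ^+ 2 by rewrite exprn_ge0// nrm_ge0.
  have [||w Sw hw] := rectangle_min _ _ gD SkD (@nsq_continuous R p) h0.
  - by rewrite lerD2l ler_wpM2r ?ler_nat ?leq_addr// ltW.
  - by rewrite lerDl ltW.
  exists w; split; first by case: Sw => /=; rewrite in_itv.
  split; first exact: SkD.
  rewrite -(@ler_pXn2r _ 2) ?nnegrE ?nrm_ge0 ?sqrtr_ge0// m2 ler_pdivlMr ?mulr_gt0//.
  apply: le_trans hw; rewrite E2 E1; apply: ler_wpM2l; first exact: exprn_ge0 (nrm_ge0 _).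
  by rewrite le_eqVlt; apply/orP; left; apply/eqP; ring.
pose x k : C := (w k).1 +i* (w k).2.
(* Skipping every second strip leaves distinct nodes at distance at least (2 |k - l| - 1) t, which
   is at least |k - l| t. *)
have xsep (k l : 'I_n.+1) : `|k%:R - l%:R| * t <= nrm (x k - x l).
  apply: le_trans (Re_le_nrm _); rewrite ReD ReN /x /=.
  have [[/andP[k1 k2] _] [/andP[l1 l2] _]] := (hw k, hw l).
  move: k1 k2 l1 l2; rewrite !E2 !E1 => k1 k2 l1 l2.
  have [kl|lk|/val_inj kl] := ltngtP k l.
  - have kl1 : k%:R + 1 <= l%:R :> R by rewrite natr1 ler_nat.
    rewrite !ler0_norm; nra.
  - have kl1 : l%:R + 1 <= k%:R :> R by rewrite natr1 ler_nat.
    rewrite !ger0_norm; nra.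
  - by rewrite kl subrr normr0 mul0r.
have zx k : nrm (z - x k) <= 2 * B.
  apply: le_trans (nrmB _ _) _; rewrite mulr_natl mulr2n lerD//; apply: DB.
  by have [_ []] := hw k.
have B20 : 0 <= 2 * B by rewrite mulr_ge0.
have := lagrange_bound sp t0 B20 xsep (fun k => (hw k).2.2) zx.
have nf : (0 : R) < n`!%:R by rewrite ltr0n fact_gt0.
have -> : (2 * (2 * B) / t) ^+ n / n`!%:R = (8 * B / s) ^+ n * (n.+1%:R ^+ n / n`!%:R).
  rewrite [RHS]mulrA -exprMn; congr (_ ^+ _ / _); rewrite /t; field.
  by rewrite !gt_eqF.
have fb : n.+1%:R ^+ n / n`!%:R <= 4 ^+ n :> R.
  by rewrite ler_pdivrMr// -!natrX -natrM ler_nat expn_le_fact.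
have Bs0 : 0 <= 8 * B / s by rewrite divr_ge0 ?mulr_ge0// ltW.
have m0 : 0 <= m by exact: sqrtr_ge0.
have q0 : 0 <= n.+1%:R ^+ n / n`!%:R :> R by rewrite divr_ge0 ?exprn_ge0.
move=> pz.
have {}pz : nrm p.[z] <= m * (32 * B / s) ^+ n.
  apply: le_trans pz _; rewrite ler_wpM2l//.
  rewrite (_ : 32 * B / s = (8 * B / s) * 4); last by field; rewrite gt_eqF.
  by rewrite [leRHS]exprMn ler_wpM2l// exprn_ge0.
have -> : K * rho ^+ n * nsq D p = nsq D p * (K * rho ^+ n) by rewrite mulrC.
apply: (@le_trans _ _ (m ^+ 2 * ((32 * B / s) ^+ 2) ^+ n)).
  have sq (X : R) : m ^+ 2 * (X ^+ 2) ^+ n = (m * X ^+ n) ^+ 2.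
    by rewrite [RHS]exprMn exprAC.
  rewrite sq.
  rewrite lerXn2r ?nnegrE ?nrm_ge0// mulr_ge0// exprn_ge0//.
  by rewrite divr_ge0 ?mulr_ge0// ltW.
rewrite m2 -[leLHS]mulrA; apply: ler_wpM2l => //.
have -> : (t * s)^-1 = 2 / s ^+ 2 * n.+1%:R by rewrite /t; field; rewrite !gt_eqF.
rewrite -[leLHS]mulrA; apply: ler_pM.
- by rewrite divr_ge0// exprn_ge0// ltW.
- by rewrite mulr_ge0// exprn_ge0// exprn_ge0// divr_ge0 ?mulr_ge0// ltW.
- by rewrite le_max lexx orbT.
apply: (@le_trans _ _ ((2 * (32 * B / s) ^+ 2) ^+ n)).
  rewrite [leRHS]exprMn; apply: ler_wpM2r; first by rewrite exprn_ge0// exprn_ge0// divr_ge0 ?mulr_ge0// ltW.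
  by rewrite -natrX ler_nat ltn_expl.
rewrite lerXn2r ?nnegrE//; last by rewrite le_max lexx orbT.
  by rewrite mulr_ge0// exprn_ge0// divr_ge0 ?mulr_ge0// ltW.
by rewrite (le_trans _ rho1).
Qed.

End PolynomialGrowth.

(** * Archipelagos *)

Section Archipelago.
Context {R : realType}.
Local Notation C := R[i].
Local Notation mu := (@area_measure R).

Lemma bmeas_slice (D : set C) (B : R) : open D -> (forall z, D z -> nrm z <= B) ->
  bounded_measurable (slice D).
Proof.
move=> oD DB; split.
  apply: open_measurable_prod.
  by move/continuousP : (@complex_pair_continuous R); apply.
exists B => -[x y] /DB xyB; split; rewrite /= in_itv /= -ler_norml.
  exact: le_trans (Re_le_nrm (x +i* y)) xyB.
exact: le_trans (Im_le_nrm (x +i* y)) xyB.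
Qed.

(** The squared norm of [P 0] is 1, but an integral over the empty set is 0. The nonemptiness of the
    islands comes from here. *)
Lemma bergman_nonempty (D : set C) (P : nat -> {poly C}) : bergman_polynomials D P -> D !=set0.
Proof.
move=> [_ _ ortho]; apply/set0P/eqP => D0; have := ortho 0%N 0%N.
rewrite L2_inner_nsq eqxx D0 /nsq.
rewrite (_ : slice set0 = set0); last by apply/seteqP; split => w.
rewrite Rintegral_set0 => -[/eqP].
by rewrite eq_sym oner_eq0.
Qed.

Lemma open_contains_square (D : set C) : open D -> D !=set0 -> exists a c s : R,
  0 < s /\ `[a, a + s]%classic `*` `[c, c + s]%classic `<=` slice D.
Proof.
move=> /openCP oD [[a c] /oD[e e0 eD]]; exists a, c, (e / 4).
split; first by rewrite divr_gt0.
move=> [x y] [] /=; rewrite !in_itv /= => /andP[x1 x2] /andP[y1 y2]; apply: eD.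
apply: le_lt_trans (nrm_le_ReIm _) _; rewrite /= !ger0_norm; lra.
Qed.

(** The kernel polynomial of [E] at [z] is a competitor on [D], where its norm is no larger; so the
    square of the kernel of [E] is at most the product of both kernels. *)
Lemma kernel_diag_mono (D E : set C) P Q n z :
  bounded_measurable (slice D) -> bounded_measurable (slice E) -> D `<=` E ->
  bergman_polynomials D P -> bergman_polynomials E Q ->
  kernel_diag Q n z <= kernel_diag P n z.
Proof.
move=> gD gE DE hP hQ.
have [p [sp pz np]] := kernel_poly gE hQ n z.
have K0 := kernel_diag_gt0 hQ n z.
have := nrm_eval_le gD hP z sp; rewrite pz expr2.
have h : nsq D p <= kernel_diag Q n z.
  rewrite -np; apply: bmeas_subset_le => //.
  - by move=> w /DE.
  - exact: nsq_continuous.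
  - by move=> w; rewrite exprn_ge0// nrm_ge0.
have P0 := kernel_diag_gt0 hP n z.
by move=> /le_trans/(_ (ler_wpM2r (ltW P0) h)); rewrite ler_pM2l.
Qed.

Lemma sqrt_christoffel_le (P Q : nat -> {poly C}) n m z (c : R) :
  0 <= c -> 0 < kernel_diag P n z -> 0 < kernel_diag Q m z ->
  c ^+ 2 * kernel_diag P n z <= kernel_diag Q m z ->
  c * sqrt_christoffel Q m z <= sqrt_christoffel P n z.
Proof.
move=> c0 P0 Q0 PQ; rewrite !sqrt_christoffelE.
rewrite ler_pdivrMr ?sqrtr_gt0// mulrC ler_pdivlMr ?sqrtr_gt0//.
by rewrite -(ger0_norm c0) -sqrtr_sqr -sqrtrM ?sqr_ge0// ler_sqrt// ltW.
Qed.

Context (N : nat) (G : 'I_N -> set C) (hG : archipelago G).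

Lemma archipelago_curves : exists L : 'I_N -> set C,
  (forall j, jordan_curve (L j)) /\ (forall j, G j = jordan_interior (L j)).
Proof.
have [_ jG _] := hG.
have /choice[L hL] : forall j, exists L, jordan_curve L /\ G j = jordan_interior L.
  by move=> j; have [L jL GL] := jG j; exists L.
by exists L; split => j; have [] := hL j.
Qed.

Lemma archipelago_open j : open (G j).
Proof.
have [L [jL ->]] := archipelago_curves; apply: jordan_interior_open.
by apply: compact_closedC; exact: jordan_compact.
Qed.

Lemma archipelago_bdd : exists2 B : R, 0 < B & forall j z, closure (G j) z -> nrm z <= B.
Proof.
have [L [jL GL]] := archipelago_curves; have [B B0 h] := filled_union_bdd jL.
by exists B => // j z Gz; apply: h; exists j => //; rewrite -GL.
Qed.

Lemma archipelago_good j : bounded_measurable (slice (G j)).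
Proof.
have [B _ h] := archipelago_bdd; have GB z : G j z -> nrm z <= B by move=> Gz; apply: (h j); exact: subset_closure.
exact: (bmeas_slice (@archipelago_open j) GB).
Qed.

Lemma archipelago_union_good : bounded_measurable (slice (\bigcup_j G j)).
Proof.
have [B _ h] := archipelago_bdd; have GB z : (\bigcup_j G j) z -> nrm z <= B.
  by move=> [j _ Gz]; apply: (h j); exact: subset_closure.
apply: (bmeas_slice _ GB).
by apply: bigcup_open => j _; exact: archipelago_open.
Qed.

Context (P : nat -> {poly C}) (hP : bergman_polynomials (\bigcup_j G j) P)
  (Pj : 'I_N -> nat -> {poly C}) (hPj : forall j, bergman_polynomials (G j) (Pj j)).

(** The competitor on the union is [p * q], with [p] the kernel polynomial of [G j] at [z] and [q]
    of degree at most [2 * n] times that of [q0]; hence [m]. As [q] has modulus at least 3/4 at [z]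
    and at most 5/4 on [G j], and the other islands add at most 1/4 of [Kj], the quotient of the
    kernels is at most 29/9, below 4. *)
Lemma kernel_diag_comparison j : exists2 m : nat, (1 <= m)%N &
  forall n z, (0 < n)%N -> closure (G j) z ->
    kernel_diag (Pj j) n z <= 4 * kernel_diag P (m * n) z.
Proof.
have [B B0 GB] := archipelago_bdd.
have GB' i z : G i z -> nrm z <= B by move=> Gz; apply: (GB i); exact: subset_closure.
have [a [c [s [s0 sG]]]] := open_contains_square (@archipelago_open j) (bergman_nonempty (hPj j)).
have [K [rho [K1 rho1 growth]]] :=
  polynomial_growth (@archipelago_good j) s0 sG (GB' j).
pose A := fine (mu (slice (\bigcup_j G j))).
have A0 : 0 <= A by exact: fine_ge0.
(* [X] collects the growth of [p] at [n = 1] and the area; [e] is chosen so that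
   [8 * e * X = 1 / 4]. *)
pose X := rho * K * (A + 1).
have X1 : 1 <= X.
  by rewrite /X; apply: mulr_ege1; [exact: mulr_ege1|lra].
have X0 : 0 < X by apply: lt_le_trans X1.
pose e := (32 * X)^-1.
have e0 : 0 < e by rewrite invr_gt0 mulr_gt0.
have eX : 8 * e * X = 1 / 4 by rewrite /e; field; rewrite gt_eqF.
have e8 : 8 * e <= 1 / 4.
  by rewrite -eX -[leLHS]mulr1 ler_wpM2l// mulr_ge0// ltW.
have e1 : e <= 1 by lra.
have e80 : 0 <= 8 * e by rewrite mulr_ge0// ltW.
have e81 : 8 * e <= 1 by lra.
have [L [jL GL]] := archipelago_curves.
have [_ _ Gdisj] := hG.
have Gne i : closure (jordan_interior (L i)) !=set0.
  have [w Gw] := bergman_nonempty (hPj i); exists w; rewrite -GL; exact: subset_closure.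
have Gdisj' i k : i != k ->
    closure (jordan_interior (L i)) `&` closure (jordan_interior (L k)) = set0.
  by move=> ik; rewrite -!GL; exact: Gdisj.
have [q0 [q1 q2]] := separating_polynomial j jL Gne Gdisj' e0.
exists (1 + 2 * (size q0).-1)%N => // n z n0 Gz.
pose q := @majority R n \Po q0.
have near1 w : closure (G j) w -> nrm (1 - q.[w]) <= 1 / 4.
  move=> Gw; rewrite horner_comp.
  apply: (le_trans (majority_near1 n e1 _)).
    by rewrite nrmBC; apply: ltW; apply: q1; rewrite -GL; exact: Gw.
  case: n n0 {q} => // n _; rewrite exprS; apply: le_trans e8.
  by rewrite ler_piMr// exprn_ile1.
have near0 i w : i != j -> G i w -> nrm q.[w] <= (8 * e) ^+ n.
  move=> ij Gw; rewrite horner_comp; apply: (majority_near0 n e1).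
  by apply: ltW; apply: (q2 i _ ij); rewrite -GL; exact: subset_closure Gw.
have qle w : closure (G j) w -> nrm q.[w] <= 5 / 4.
  move=> /near1; have := nrm_sub_ge q.[w] 1; rewrite nrmBC Normc.normc1; lra.
have qge : 3 / 4 <= nrm q.[z].
  by have := near1 z Gz; have := nrm_sub_ge 1 q.[z]; rewrite Normc.normc1; lra.
have [p [sp pz np]] := kernel_poly (@archipelago_good j) (hPj j) n z.
set Kj := kernel_diag (Pj j) n z in pz np *.
have Kj0 : 0 < Kj := kernel_diag_gt0 (hPj j) n z.
have spq : (size (p * q)%R <= ((1 + 2 * (size q0).-1) * n).+1)%N.
  apply: leq_trans (size_polyMleq _ _) _.
  have sq : (size q <= (2 * n * (size q0).-1).+1)%N.
    apply: leq_trans (size_comp_poly_leq _ _) _; rewrite ltnS leq_mul2r; apply/orP; right.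
    by have := @size_majority R n; case: (size (majority n)).
  apply: leq_trans (_ : (n.+1 + (2 * n * (size q0).-1).+1).-1 <= _)%N.
    by have := leq_add sp sq; rewrite addnS; case: (size p + size q)%N.
  by rewrite addnS /= addSn ltnS mulnDl mul1n leq_add2l mulnAC.
have := nrm_eval_le archipelago_union_good hP z spq.
set KG := kernel_diag P _ z.
have KG0 : 0 < KG by exact: (kernel_diag_gt0 hP).
rewrite hornerM nrmM pz => eval.
have npq : nsq (\bigcup_j G j) (p * q) <= 29 / 16 * Kj.
  pose M := ((8 * e) ^+ n) ^+ 2 * (K * rho ^+ n * Kj).
  have M0 : 0 <= M.
    have rho0 : 0 <= rho by lra.
    by rewrite !mulr_ge0 ?exprn_ge0//; lra.
  have MA : M * A <= 1 / 4 * Kj.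
    (* [y ^+ n] gathers all dependence of [M] on [n] other than through [Kj]; as [y <= 1] and [n] is
       positive, it is at most [y]. *)
    pose y := (8 * e) ^+ 2 * rho.
    have y0 : 0 <= y by rewrite mulr_ge0 ?exprn_ge0//; lra.
    have yKA : y * K * (A + 1) <= 1 / 4.
      rewrite (_ : _ * _ = 8 * e * (8 * e * X)); last by rewrite /y /X; ring.
      by rewrite eX; lra.
    have y1 : y <= 1.
      apply: le_trans (_ : y * K * (A + 1) <= _); last by lra.
      rewrite -mulrA -[leLHS]mulr1 ler_wpM2l//; apply: mulr_ege1 => //; lra.
    have yn : y ^+ n <= y.
      by case: n n0 {q sp pz np spq eval near1 near0 qle qge Kj Kj0 KG KG0 M M0} => // n _;
        rewrite exprS ler_piMr// exprn_ile1.
    rewrite (_ : M * A = y ^+ n * (K * A) * Kj); last first.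
      have -> : y ^+ n = ((8 * e) ^+ n) ^+ 2 * rho ^+ n by rewrite /y [LHS]exprMn exprAC.
      by rewrite /M; ring.
    apply: ler_wpM2r; first exact: ltW.
    have KA0 : 0 <= K * A by rewrite mulr_ge0//; lra.
    apply: le_trans (ler_wpM2r KA0 yn) _; apply: le_trans yKA.
    by rewrite -mulrA ler_wpM2l// ler_wpM2l//; lra.
  apply: (@le_trans _ _ (25 / 16 * nsq (G j) p + M * A)); last by rewrite np; lra.
  apply: bmeas_split_le.
  - exact: archipelago_good.
  - exact: archipelago_union_good.
  - by move=> w Gw; exists j.
  - exact: nsq_continuous.
  - exact: nsq_continuous.
  - exact: M0.
  - move=> w Gw; rewrite hornerM nrmM exprMn mulrC; apply: ler_wpM2r.
      by rewrite exprn_ge0// nrm_ge0.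
    have Gw' : closure (G j) (w.1 +i* w.2) by exact: subset_closure.
    have := qle _ Gw'; have := nrm_ge0 q.[w.1 +i* w.2]; nra.
  - move=> w [i _ Gw] nGw; rewrite hornerM nrmM exprMn mulrC.
    have ij : i != j by apply/eqP => ij; apply: nGw; rewrite -ij.
    apply: ler_pM; rewrite ?exprn_ge0 ?nrm_ge0//.
      by rewrite lerXn2r ?nnegrE ?nrm_ge0 ?(near0 i)// exprn_ge0// mulr_ge0// ltW.
    by rewrite -np; apply: growth => //; exact: GB' Gw.
have : (Kj * (3 / 4)) ^+ 2 <= 29 / 16 * Kj * KG.
  apply: (le_trans _ (le_trans eval (ler_wpM2r (ltW KG0) npq))).
  rewrite lerXn2r ?nnegrE ?mulr_ge0 ?nrm_ge0 ?ler_wpM2l ?(ltW Kj0)//; lra.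
rewrite (_ : (Kj * (3 / 4)) ^+ 2 = Kj * (9 / 16 * Kj)); last by field.
rewrite (_ : 29 / 16 * Kj * KG = Kj * (29 / 16 * KG)); last by field.
rewrite ler_pM2l//; lra.
Qed.

Lemma kernel_diag0 (Q : nat -> {poly C}) D z : bergman_polynomials D Q ->
  kernel_diag Q 0 z = kernel_diag Q 0 0.
Proof.
move=> [sQ _ _]; rewrite /kernel_diag !big_ord1.
have /size_poly1P[c _ ->] : size (Q 0%N) == 1%N by rewrite sQ.
by rewrite !hornerC.
Qed.

End Archipelago.

Theorem theorem4p2 (R : realType) (N : nat) (G : 'I_N -> set R[i])
    (hG : archipelago G)
    (P : nat -> {poly R[i]}) (hP : bergman_polynomials (\bigcup_j G j) P)
    (Pj : 'I_N -> nat -> {poly R[i]})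
    (hPj : forall j : 'I_N, bergman_polynomials (G j) (Pj j)) :
  forall j : 'I_N,
    (forall (n : nat) (z : R[i]),
        sqrt_christoffel (Pj j) n z <= sqrt_christoffel P n z) /\
    (analytic_jordan_curve (boundary (G j)) ->
      exists (gamma : nat -> R) (m : nat),
        [/\ (forall n : nat, 0 < gamma n < 1),
            gamma n @[n --> \oo] --> 0,
            (exists2 alpha : R, 0 < alpha < 1 &
               gamma =O_\oo (fun n : nat => alpha ^+ n)),
            (1 <= m)%N &
            forall (n : nat) (z : R[i]), closure (G j) z ->
              (1 - gamma n) / 2 * sqrt_christoffel P (m * n) z
                <= sqrt_christoffel (Pj j) n z]).
Proof.
move=> j.
have kP n z : 0 < kernel_diag P n z by exact: (kernel_diag_gt0 hP).
have kPj n z : 0 < kernel_diag (Pj j) n z by exact: (kernel_diag_gt0 (hPj j)).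
split=> [n z|_].
  rewrite -[leLHS]mul1r; apply: sqrt_christoffel_le => //.
  rewrite expr1n mul1r; apply: (@kernel_diag_mono R (G j) (\bigcup_j G j)) => //.
  - exact: archipelago_good.
  - exact: archipelago_union_good.
  - by move=> w Gw; exists j.
have [m m1 mh] := kernel_diag_comparison hG hP hPj j.
(* In degree 0 both kernels are constant in [z], and the inequality to be met is
   [(eps / 2) ^+ 2 <= r]; it follows from [eps <= 2 * r] together with [eps <= 1 / 2]. *)
pose r := kernel_diag P 0 0 / kernel_diag (Pj j) 0 0.
have r0 : 0 < r by rewrite divr_gt0.
pose eps := Num.min (1 / 2) (2 * r).
have eps0 : 0 < eps by rewrite lt_min; apply/andP; split; [rewrite divr_gt0|rewrite mulr_gt0].
have eps1 : eps <= 1 / 2 by rewrite ge_min lexx.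
have eps2 : eps <= 2 * r by rewrite ge_min lexx orbT.
pose gamma n : R := (1 - eps) * (1 / 2) ^+ n.
have gamma01 n : 0 < gamma n < 1.
  have h1 : 0 < (1 / 2) ^+ n :> R by rewrite exprn_gt0// divr_gt0.
  have h2 : (1 / 2) ^+ n <= 1 :> R by rewrite exprn_ile1//; lra.
  by rewrite /gamma; apply/andP; split; nra.
exists gamma, m; split => //.
- have -> : 0 = (1 - eps) * 0 by rewrite mulr0.
  apply: cvgM; first exact: cvg_cst.
  by apply: cvg_expr; rewrite ger0_norm; lra.
- exists (1 / 2); first by apply/andP; split; lra.
  apply/eqO_exP; exists 1 => //; near=> n.
  have h1 : 0 < (1 / 2) ^+ n :> R by rewrite exprn_gt0// divr_gt0.
  have /andP[g0 _] := gamma01 n.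
  rewrite mul1r gtr0_norm// gtr0_norm// /gamma; nra.
- move=> n z Gz; have /andP[g0 g1] := gamma01 n.
  apply: sqrt_christoffel_le => //; first by rewrite divr_ge0//; lra.
  have [n0|n0] := posnP n.
    rewrite /gamma n0 muln0 expr0 mulr1 (kernel_diag0 _ hP) (kernel_diag0 _ (hPj j)).
    rewrite -ler_pdivlMr// -/r; apply: (@le_trans _ _ (eps / 2)); last by lra.
    by rewrite (_ : 1 - (1 - eps) = eps); [nra|ring].
  (* The factor 4 of the comparison is exactly what [((1 - gamma n) / 2) ^+ 2 <= 1 / 4] pays for. *)
  have h := mh n z n0 Gz; have k0 := kPj n z.
  have : ((1 - gamma n) / 2) ^+ 2 <= 1 / 4 by nra.
  by nra.
Unshelve. all: by end_near. Qed.
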